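(* Let $H$ be the graph on vertex set $\{0,1,2,3\}$ with one red edge $\{0,2\}$ and three blue edges $\{0,1\},\{0,3\},\{1,3\}$. Then there is $n_0$ such that, for every $n\ge n_0$, every graph $G$ of order $n$ with $\Lambda_H(G)=\Lambda_H(n)$ is a blowup of $K_2$.
   Context: All graphs are finite and simple; the order of a graph is its number of vertices. For a graph $H$ whose edges are coloured red or blue and an uncoloured graph $G$, an embedding of $H$ into $G$ is an injection $V(H)\to V(G)$ that maps red edges of $H$ to edges of $G$ and blue edges of $H$ to non-edges of $G$ (pairs of distinct non-adjacent vertices). $\Lambda_H(G)$ is the number of embeddings of $H$ into $G$, and $\Lambda_H(n)$ is the maximum of $\Lambda_H(G)$ over all graphs $G$ of order $n$. A blowup of $K_2$ is a graph whose vertex set is the disjoint union of two sets $V_0,V_1$ (possibly empty) in which two vertices are adjacent if and only if they lie in different sets, i.e. a complete bipartite graph. *)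

(* Defs.v *)
From HB Require Import structures.
From mathcomp Require Import all_boot.

Set Implicit Arguments.
Unset Strict Implicit.
Unset Printing Implicit Defensive.

(* Simple graphs and red/blue edge-coloured simple graphs are given by sets of
   edges, an edge being a two-element set of vertices. *)
Definition edge_family (V : finType) (E : {set {set V}}) : bool :=
  [forall e in E, #|e| == 2].

Record graph (V : finType) := Graph {
  edges :> {set {set V}};
  edgesP : edge_family edges }.

HB.instance Definition _ (V : finType) := [isSub for @edges V].
HB.instance Definition _ (V : finType) := [Finite of graph V by <:].

Record cgraph (U : finType) := CGraph {
  red : {set {set U}};
  blue : {set {set U}};
  redP : edge_family red;
  blueP : edge_family blue;
  red_blueP : [disjoint red & blue] }.

Definition adj (V : finType) (G : graph V) : rel V :=
  fun u v => [set u; v] \in edges G.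

(* As f is injective, the image f @: e of an edge e is again a pair of distinct
   vertices, so that f @: e \notin edges G says that it is a non-edge. *)
Definition embedding (U V : finType) (H : cgraph U) (G : graph V)
    (f : {ffun U -> V}) : bool :=
  [&& injectiveb f,
      [forall e in red H, f @: e \in edges G] &
      [forall e in blue H, f @: e \notin edges G]].

Definition Lambda (U V : finType) (H : cgraph U) (G : graph V) : nat :=
  #|[set f : {ffun U -> V} | embedding H G f]|.

(* Lambda H G is invariant under isomorphism of G, so the maximum over all
   graphs of order n is attained on the vertex set 'I_n. *)
Definition Lambda_max (U : finType) (H : cgraph U) (n : nat) : nat :=
  \max_(G : graph 'I_n) Lambda H G.

Definition blowup_K2 (V : finType) (G : graph V) : Prop :=
  exists V0 V1 : {set V},
    [/\ V0 :|: V1 = [set: V],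
        [disjoint V0 & V1] &
        forall u v : V,
          adj G u v = ((u \in V0) && (v \in V1)) || ((u \in V1) && (v \in V0))].

Local Notation "'v_ k" := (@Ordinal 4 k isT) (at level 8, k at level 2).

Definition H_red : {set {set 'I_4}} := [set [set 'v_0; 'v_2]].
Definition H_blue : {set {set 'I_4}} :=
  [set [set 'v_0; 'v_1]; [set 'v_0; 'v_3]; [set 'v_1; 'v_3]].

Lemma H_redP : edge_family H_red.
Proof. by apply/forall_inP => e; rewrite !inE => /eqP->; rewrite cards2. Qed.

Lemma H_blueP : edge_family H_blue.
Proof.
by apply/forall_inP => e; rewrite !inE => /orP[/orP[]|] /eqP->; rewrite cards2.
Qed.

Lemma H_red_blueP : [disjoint H_red & H_blue].
Proof.
rewrite /H_red disjoints1 !inE !negb_or -!andbA.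
by apply/and3P; split; apply/eqP => /setP/(_ 'v_2); rewrite !inE.
Qed.

Definition H : cgraph 'I_4 := CGraph H_redP H_blueP H_red_blueP.

(* Main.v *)
(** An embedding of H is a vertex x with a neighbour t and two vertices y, z
    such that x, y, z are independent. A flag algebra certificate on five
    vertices bounds the density of such quadruples by 1/8 and shows that near
    equality most edges xy have few common neighbours and few common
    non-neighbours. An exact identity writes the count as (M (C - M) - L) / 2,
    where M is the degree sum, C = n^2 - 3n + 4 and L sums over the edges a
    deficit that vanishes on complete bipartite graphs; together with the
    certificate it forces almost all degrees to be close to n/2. Replacing a
    vertex by a clone of another one shows that in an extremal graph all
    vertices lie in nearly equally many embeddings, whence every degree is close
    to n/2 or to 0. If none is close to 0, then L is at least n/5 times the
    number of odd triples (triples spanning an odd number of edges) on the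
    edges; a single odd triple gives linearly many of them, so that the count
    drops by more than 6n below C^2/8, a value that complete bipartite graphs
    reach up to an error 6n. Vertices of degree close to 0 cost even more, of
    order n^2. Hence there are no odd triples, which means complete bipartite.
    *)

Require Import Defs.
From Stdlib Require Import ZArith.
From mathcomp Require Import all_boot all_order all_algebra.
From mathcomp Require Import ssrZ ring lra zify.

Set Implicit Arguments.
Unset Strict Implicit.
Unset Printing Implicit Defensive.

Import Order.TTheory GRing.Theory Num.Theory.
Delimit Scope Z_scope with Z.
Local Open Scope ring_scope.


(** * Weighted sums over the vertices, covering both plain sums and means *)

Section Average.

Variables (R : realFieldType) (V : finType) (w : R).
Implicit Types (f g : V -> R) (F : V -> V -> R).

(* Only the values 1 (sums) and 1 / #|V| (means) of [w] are of interest. *)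
(* Locked, lest rewriting with product rules should split off [w]. *)
Definition avg f : R := locked (w * \sum_x f x).

Lemma avgE f : avg f = w * \sum_x f x.
Proof. by rewrite /avg -lock. Qed.

Lemma eq_avg f g : f =1 g -> avg f = avg g.
Proof. by move=> fg; rewrite !avgE (eq_bigr _ (fun x _ => fg x)). Qed.

Lemma avgD f g : avg (fun x => f x + g x) = avg f + avg g.
Proof. by rewrite !avgE big_split mulrDr. Qed.

Lemma avgN f : avg (fun x => - f x) = - avg f.
Proof. by rewrite !avgE sumrN mulrN. Qed.

Lemma avgB f g : avg (fun x => f x - g x) = avg f - avg g.
Proof. by rewrite avgD avgN. Qed.

Lemma avgZ c f : avg (fun x => c * f x) = c * avg f.
Proof. by rewrite !avgE -mulr_sumr mulrCA. Qed.

Lemma avgZr c f : avg (fun x => f x * c) = avg f * c.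
Proof. by rewrite !avgE -mulr_suml mulrA. Qed.

Lemma avg_cst c : avg (fun=> c) = c * avg (fun=> 1).
Proof. by rewrite -avgZ; apply: eq_avg => x; rewrite mulr1. Qed.

Lemma exchange_avg F :
  avg (fun x => avg (F x)) = avg (fun y => avg (F^~ y)).
Proof.
rewrite !avgE; under eq_bigr do rewrite avgE.
by under [in RHS]eq_bigr do rewrite avgE; rewrite -!mulr_sumr exchange_big.
Qed.

Hypothesis w_ge0 : 0 <= w.

Lemma avg_ge0 f : (forall x, 0 <= f x) -> 0 <= avg f.
Proof. by move=> f0; rewrite avgE mulr_ge0 ?sumr_ge0. Qed.

Lemma le_avg f g : (forall x, f x <= g x) -> avg f <= avg g.
Proof. by move=> fg; rewrite !avgE ler_wpM2l ?ler_sum. Qed.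

End Average.


(** * Symmetrisation of functions of five vertices *)

Section Symmetrisation.

Variables (T : Type) (S : nmodType).
Implicit Types F G : T -> T -> T -> T -> T -> S.

Definition add5 F G := fun x0 x1 x2 x3 x4 => F x0 x1 x2 x3 x4 + G x0 x1 x2 x3 x4.
Definition swap01 F := fun x0 x1 x2 x3 x4 => F x1 x0 x2 x3 x4.
Definition swap12 F := fun x0 x1 x2 x3 x4 => F x0 x2 x1 x3 x4.
Definition swap23 F := fun x0 x1 x2 x3 x4 => F x0 x1 x3 x2 x4.
Definition swap34 F := fun x0 x1 x2 x3 x4 => F x0 x1 x2 x4 x3.

(* [cosetk] sums over the k cyclic shifts that represent the cosets of the
   symmetric group on k - 1 letters in that on k letters. *)
Definition coset2 F := add5 F (swap01 F).
Definition coset3 F := add5 F (swap12 (coset2 F)).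
Definition coset4 F := add5 F (swap23 (coset3 F)).
Definition coset5 F := add5 F (swap34 (coset4 F)).
Definition symm5 F := coset2 (coset3 (coset4 (coset5 F))).

End Symmetrisation.

Local Notation rel_on_5 F A := (fun x0 x1 x2 x3 x4 => F (A x0 x1) (A x0 x2)
  (A x0 x3) (A x0 x4) (A x1 x2) (A x1 x3) (A x1 x4) (A x2 x3) (A x2 x4) (A x3 x4)).

(** * The flag algebra certificate and its verification *)

Section Certificate.

Implicit Types p q r : bool.

(* Three-vertex flags rooted at x: [p], [q] and [r] indicate the pairs xy, xz
   and yz. The weights of [flag_mix] cancel on the flags at every vertex of the
   extremal graph and at an isolated vertex added to it. *)
Definition flag_mix p q r : Z :=
  match p, q, r with
  | false, false, false | true, true, false => 15
  | false, true, false | true, false, false => -5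
  | true, true, true => -12
  | _, _, true => -15
  end%Z.
Definition flag_single p q r : Z := if [&& p (+) q & ~~ r] then 1 else 0.
Definition flag_triangle p q r : Z := if [&& p, q & r] then 1 else 0.

(* Four-vertex flags rooted at x, y, z where xy is an edge and z is adjacent to
   neither x nor y: [p], [q] and [r] indicate the adjacency of the fourth
   vertex to x, y and z. *)
Definition flag_diff (k0 k1 : Z) p q r : Z :=
  match p, q with
  | true, false => if r then k1 else k0
  | false, true => if r then - k1 else - k0
  | _, _ => 0
  end%Z.
Definition flag_none (k0 k1 k2 : Z) p q r : Z :=
  match p, q with
  | false, false => if r then k1 else k0
  | true, true => 0
  | _, _ => if r then k2 else 0
  end%Z.

Definition edge_type a01 a02 a12 : bool := [&& a01, ~~ a02 & ~~ a12].
(** Vertices 0, 1, 3 and 2 of [H] are placed at [x0], [x1], [x2] and [x3]. *)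
Definition copattern a01 a02 a03 a12 : bool := [&& a03, ~~ a01, ~~ a02 & ~~ a12].
Definition far_pair a01 a02 a03 a12 a13 : bool :=
  [&& a01, ~~ a02, ~~ a12, ~~ a03 & ~~ a13].

(** The two copies of a flag share only the root [x0], so averaging over the other four vertices
    turns each product into a square. *)
Definition sos1 a01 a02 a12 a03 a04 a34 : Z :=
  (flag_mix a01 a02 a12 * flag_mix a03 a04 a34
   + 35 * (flag_single a01 a02 a12 * flag_single a03 a04 a34)
   + 36 * (flag_triangle a01 a02 a12 * flag_triangle a03 a04 a34))%Z.
Definition sos3 a03 a13 a23 a04 a14 a24 : Z :=
  (48 * (flag_diff 5 2 a03 a13 a23 * flag_diff 5 2 a04 a14 a24)
   + 348 * (flag_diff 0 1 a03 a13 a23 * flag_diff 0 1 a04 a14 a24)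
   + 24 * (flag_none (-2) 6 5 a03 a13 a23 * flag_none (-2) 6 5 a04 a14 a24)
   + 60 * (flag_none 1 (-2) 0 a03 a13 a23 * flag_none 1 (-2) 0 a04 a14 a24)
   + 24 * (flag_none 1 (-3) 0 a03 a13 a23 * flag_none 1 (-3) 0 a04 a14 a24))%Z.

(* The weights come from a rounded solution of the semidefinite programme of the
   flag algebra method on five vertices. *)
Definition certificate a01 a02 a03 a04 a12 a13 a14 a23 a24 a34 : Z :=
  (225 - (if copattern a01 a02 a03 a12 then 1800 else 0)
   - (if far_pair a01 a02 a03 a12 a13 then 4 else 0)
   - (if [&& a01, a02 & a12] then 4 else 0)
   - sos1 a01 a02 a12 a03 a04 a34
   - (if edge_type a01 a02 a12 then sos3 a03 a13 a23 a04 a14 a24 else 0))%Z.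

Definition forall_bool10 (P : bool -> bool -> bool -> bool -> bool -> bool ->
    bool -> bool -> bool -> bool -> bool) :=
  let B Q := Q true && Q false in
  B (fun a => B (fun b => B (fun c => B (fun d => B (fun e => B (fun f =>
  B (fun g => B (fun h => B (fun i => B (fun j => P a b c d e f g h i j)))))))))).

Lemma forall_bool10P P : forall_bool10 P ->
  forall a b c d e f g h i j, P a b c d e f g h i j.
Proof.
have H Q : Q true && Q false -> forall b, Q b by case/andP=> ? ? [].
move=> hP a b c d e f g h i j.
by move: hP => /H/(_ a)/H/(_ b)/H/(_ c)/H/(_ d)/H/(_ e)/H/(_ f)/H/(_ g)/H/(_ h)
  /H/(_ i)/H/(_ j).
Qed.

Definition pattern a01 a02 a03 a04 a12 a13 a14 a23 a24 a34 (i j : nat) : bool :=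
  match i, j with
  | 0, 1 | 1, 0 => a01 | 0, 2 | 2, 0 => a02 | 0, 3 | 3, 0 => a03
  | 0, 4 | 4, 0 => a04 | 1, 2 | 2, 1 => a12 | 1, 3 | 3, 1 => a13
  | 1, 4 | 4, 1 => a14 | 2, 3 | 3, 2 => a23 | 2, 4 | 4, 2 => a24
  | 3, 4 | 4, 3 => a34 | _, _ => false
  end.

(** All 1024 adjacency patterns are evaluated by computation. None is excluded, so the inequality
    also covers tuples with repeated vertices, and the averages need no error term. *)
Lemma pattern_check a01 a02 a03 a04 a12 a13 a14 a23 a24 a34 :
  Z.leb 0 (symm5 (rel_on_5 certificate
    (pattern a01 a02 a03 a04 a12 a13 a14 a23 a24 a34)) 0%N 1%N 2%N 3%N 4%N).
Proof.
pose P a01 a02 a03 a04 a12 a13 a14 a23 a24 a34 := Z.leb 0 (symm5 (rel_on_5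
  certificate (pattern a01 a02 a03 a04 a12 a13 a14 a23 a24 a34))
  0%N 1%N 2%N 3%N 4%N).
have hP : forall_bool10 P by vm_cast_no_check (erefl true).
exact: (forall_bool10P hP a01 a02 a03 a04 a12 a13 a14 a23 a24 a34).
Qed.

End Certificate.

(** * Averages of integer-valued functions of five vertices *)

Section IntegerAverages.

Variables (R : realFieldType) (V : finType) (w : R).

(** The certificate takes values in [Z], where evaluation is fast; the averages live in an ordered
    field. *)
Definition zcast (z : Z) : R := (int_of_Z z)%:~R.

Lemma zcastD x y : zcast (x + y)%Z = zcast x + zcast y.
Proof. by rewrite /zcast (rmorphD int_of_Z) intrD. Qed.

Lemma zcastM x y : zcast (x * y)%Z = zcast x * zcast y.
Proof. by rewrite /zcast (rmorphM int_of_Z) intrM. Qed.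

Lemma zcastN x : zcast (- x)%Z = - zcast x.
Proof. by rewrite /zcast (rmorphN int_of_Z) intrN. Qed.

Lemma zcastB x y : zcast (x - y)%Z = zcast x - zcast y.
Proof. by rewrite -zcastN -zcastD. Qed.

Lemma zcast_if (b : bool) z : zcast (if b then z else 0%Z) = b%:R * zcast z.
Proof. by case: b; rewrite ?mul1r ?mul0r. Qed.

Lemma zcast_ge0 z : Z.leb 0 z -> 0 <= zcast z.
Proof. by move=> z0; rewrite ler0z; lia. Qed.

Local Notation "'\E_' x F" := (avg w (fun x : V => F))
  (at level 41, x name, F at level 41).

Implicit Types F G : V -> V -> V -> V -> V -> Z.

Definition avg5 F :=
  \E_x0 \E_x1 \E_x2 \E_x3 \E_x4 zcast (F x0 x1 x2 x3 x4).

Lemma avg5D F G : avg5 (add5 F G) = avg5 F + avg5 G.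
Proof.
rewrite /avg5 -avgD; apply: eq_avg => x0; rewrite -avgD; apply: eq_avg => x1.
rewrite -avgD; apply: eq_avg => x2; rewrite -avgD; apply: eq_avg => x3.
by rewrite -avgD; apply: eq_avg => x4; exact: zcastD.
Qed.

Lemma avg5_swap01 F : avg5 (swap01 F) = avg5 F.
Proof. by rewrite /avg5 exchange_avg. Qed.

Lemma avg5_swap12 F : avg5 (swap12 F) = avg5 F.
Proof. by apply: eq_avg => x0; rewrite exchange_avg. Qed.

Lemma avg5_swap23 F : avg5 (swap23 F) = avg5 F.
Proof. by apply: eq_avg => x0; apply: eq_avg => x1; rewrite exchange_avg. Qed.

Lemma avg5_swap34 F : avg5 (swap34 F) = avg5 F.
Proof.
by apply: eq_avg => x0; apply: eq_avg => x1; apply: eq_avg => x2; rewrite exchange_avg.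
Qed.

(** Each of the [120 = 2 * 3 * 4 * 5] summands is [F] with permuted arguments, and the order of
    averaging may be exchanged. *)
Lemma avg5_symm5 F : avg5 (symm5 F) = 120%:R * avg5 F.
Proof.
have swapE := (avg5_swap01, avg5_swap12, avg5_swap23, avg5_swap34).
have E2 G : avg5 (coset2 G) = 2%:R * avg5 G.
  by rewrite avg5D swapE; ring.
have E3 G : avg5 (coset3 G) = 3%:R * avg5 G.
  by rewrite avg5D swapE E2; ring.
have E4 G : avg5 (coset4 G) = 4%:R * avg5 G.
  by rewrite avg5D swapE E3; ring.
have E5 G : avg5 (coset5 G) = 5%:R * avg5 G.
  by rewrite avg5D swapE E4; ring.
by rewrite E2 E3 E4 E5; ring.
Qed.

Hypothesis w_ge0 : 0 <= w.

Lemma avg5_ge0 F : (forall x0 x1 x2 x3 x4, Z.leb 0 (F x0 x1 x2 x3 x4)) -> 0 <= avg5 F.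
Proof.
move=> F0; do 5!apply: avg_ge0 => // ?.
exact: zcast_ge0.
Qed.

(** For a fixed root the average over two disjoint pairs factors into the square of a single
    average. *)
Lemma avg5_root1 (l : V -> V -> V -> Z) :
  0 <= \E_x0 \E_x1 \E_x2 \E_x3 \E_x4 zcast (l x0 x1 x2) * zcast (l x0 x3 x4).
Proof.
apply: avg_ge0 => // x0.
have -> : \E_x1 \E_x2 \E_x3 \E_x4 zcast (l x0 x1 x2) * zcast (l x0 x3 x4) =
    (\E_x1 \E_x2 zcast (l x0 x1 x2)) ^+ 2; last exact: sqr_ge0.
rewrite expr2 -avgZr; apply: eq_avg => x1; rewrite -avgZr; apply: eq_avg => x2.
by rewrite -avgZ; apply: eq_avg => x3; rewrite avgZ.
Qed.

Lemma avg5_root3 (s : V -> V -> V -> bool) (l : V -> V -> V -> V -> Z) :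
  0 <= \E_x0 \E_x1 \E_x2 \E_x3 \E_x4
    (s x0 x1 x2)%:R * (zcast (l x0 x1 x2 x3) * zcast (l x0 x1 x2 x4)).
Proof.
apply: avg_ge0 => // x0; apply: avg_ge0 => // x1; apply: avg_ge0 => // x2.
have -> : \E_x3 \E_x4 (s x0 x1 x2)%:R * (zcast (l x0 x1 x2 x3) * zcast (l x0 x1 x2 x4)) =
    (s x0 x1 x2)%:R * (\E_x3 zcast (l x0 x1 x2 x3)) ^+ 2.
  rewrite expr2 -avgZr -avgZ; apply: eq_avg => x3.
  by rewrite avgZ avgZ.
by rewrite mulr_ge0 ?ler0n ?sqr_ge0.
Qed.

End IntegerAverages.

(** * From the certificate to a bound on densities *)

Section FlagBound.

Variables (R : realFieldType) (V : finType) (w : R) (A : rel V).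
Hypotheses (w_ge0 : 0 <= w) (w_mean : avg w (fun _ : V => 1) = 1).
Hypothesis A_sym : symmetric A.

Local Notation "'\E_' x F" := (avg w (fun x : V => F))
  (at level 41, x name, F at level 41).

Lemma certificate_ge0 : 0 <= avg5 w (rel_on_5 certificate A).
Proof.
suff: 0 <= avg5 w (symm5 (rel_on_5 certificate A)).
  by rewrite avg5_symm5 pmulr_rge0 ?ltr0n.
apply: avg5_ge0 => // x0 x1 x2 x3 x4.
have := pattern_check (A x0 x1) (A x0 x2) (A x0 x3) (A x0 x4) (A x1 x2) (A x1 x3)
  (A x1 x4) (A x2 x3) (A x2 x4) (A x3 x4).
cbv beta iota delta [symm5 coset2 coset3 coset4 coset5 add5 swap01 swap12 swap23
  swap34 pattern].
(* Every adjacency gets its smaller index first, to agree with the values of [pattern]. *)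
rewrite !(A_sym x1 x0) !(A_sym x2 x0) !(A_sym x3 x0) !(A_sym x4 x0) !(A_sym x2 x1).
by rewrite !(A_sym x3 x1) !(A_sym x4 x1) !(A_sym x3 x2) !(A_sym x4 x2) !(A_sym x4 x3).
Qed.


Definition mean5 (G : V -> V -> V -> V -> V -> R) :=
  \E_x0 \E_x1 \E_x2 \E_x3 \E_x4 G x0 x1 x2 x3 x4.

Lemma eq_mean5 G H :
  (forall x0 x1 x2 x3 x4, G x0 x1 x2 x3 x4 = H x0 x1 x2 x3 x4) -> mean5 G = mean5 H.
Proof.
move=> GH; apply: eq_avg => x0; apply: eq_avg => x1; apply: eq_avg => x2.
by apply: eq_avg => x3; apply: eq_avg => x4; rewrite GH.
Qed.

Lemma mean5D G H : mean5 (fun x0 x1 x2 x3 x4 => G x0 x1 x2 x3 x4 + H x0 x1 x2 x3 x4) =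
  mean5 G + mean5 H.
Proof.
rewrite /mean5 -avgD; apply: eq_avg => x0; rewrite -avgD; apply: eq_avg => x1.
rewrite -avgD; apply: eq_avg => x2; rewrite -avgD; apply: eq_avg => x3.
by rewrite -avgD; apply: eq_avg.
Qed.

Lemma mean5Z k G : mean5 (fun x0 x1 x2 x3 x4 => k * G x0 x1 x2 x3 x4) = k * mean5 G.
Proof.
rewrite /mean5 -avgZ; apply: eq_avg => x0; rewrite -avgZ; apply: eq_avg => x1.
rewrite -avgZ; apply: eq_avg => x2; rewrite -avgZ; apply: eq_avg => x3.
by rewrite -avgZ; apply: eq_avg.
Qed.

Lemma mean_cst k : \E__ k = k.
Proof. by rewrite avg_cst w_mean mulr1. Qed.

Definition adjr x y : R := (A x y)%:R.
Definition nadjr x y : R := (~~ A x y)%:R.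
Definition mdeg x := \E_y adjr x y.
Definition mcodeg x y := \E_z adjr x z * adjr y z.
Definition mfar x y := \E_z nadjr x z * nadjr y z.
Definition mcoindep x := \E_y \E_z nadjr x y * nadjr x z * nadjr y z.
Definition copattern_density := \E_x mdeg x * mcoindep x.

(** The averages of squares are nonnegative and are dropped. As [225 / 1800 = 1/8], the density is
    at most [1/8], and the two averages on the left add up to at most 450 times its distance from
    [1/8]. *)
Theorem flag_bound :
  4%:R * ((\E_x \E_y adjr x y * mfar x y ^+ 2) + (\E_x \E_y adjr x y * mcodeg x y)) <=
  225%:R - 1800%:R * copattern_density.
Proof.
pose F0 x0 x1 x2 x3 (_ : V) := adjr x0 x3 * (nadjr x0 x1 * nadjr x0 x2 * nadjr x1 x2).
pose F1 x0 x1 x2 x3 (_ : V) :=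
  adjr x0 x1 * ((nadjr x0 x2 * nadjr x1 x2) * (nadjr x0 x3 * nadjr x1 x3)).
pose F2 x0 x1 x2 (_ _ : V) := adjr x0 x1 * (adjr x0 x2 * adjr x1 x2).
pose G1 (l : bool -> bool -> bool -> Z) (x0 x1 x2 x3 x4 : V) :=
  zcast R (l (A x0 x1) (A x0 x2) (A x1 x2)) * zcast R (l (A x0 x3) (A x0 x4) (A x3 x4)).
pose G3 (l : bool -> bool -> bool -> Z) (x0 x1 x2 x3 x4 : V) :=
  (edge_type (A x0 x1) (A x0 x2) (A x1 x2))%:R *
  (zcast R (l (A x0 x3) (A x1 x3) (A x2 x3)) * zcast R (l (A x0 x4) (A x1 x4) (A x2 x4))).
have F0E : mean5 F0 = copattern_density.
  apply: eq_avg => x0; rewrite mulrC -avgZr; apply: eq_avg => x1.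
  rewrite -avgZr; apply: eq_avg => x2; rewrite mulrC -avgZr.
  by apply: eq_avg => x3; rewrite /F0 mean_cst.
have F1E : mean5 F1 = \E_x \E_y adjr x y * mfar x y ^+ 2.
  apply: eq_avg => x0; apply: eq_avg => x1; rewrite expr2 -avgZr -avgZ.
  apply: eq_avg => x2; rewrite -avgZ -avgZ; apply: eq_avg => x3.
  by rewrite /F1 mean_cst.
have F2E : mean5 F2 = \E_x \E_y adjr x y * mcodeg x y.
  apply: eq_avg => x0; apply: eq_avg => x1; rewrite -avgZ; apply: eq_avg => x2.
  by rewrite /F2 !mean_cst.
have G1_ge0 l : 0 <= mean5 (G1 l).
  exact: (avg5_root1 w_ge0 (fun x y z => l (A x y) (A x z) (A y z))).
have G3_ge0 l : 0 <= mean5 (G3 l).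
  exact: (avg5_root3 w_ge0 (fun x y z => edge_type (A x y) (A x z) (A y z))
    (fun x y z t => l (A x t) (A y t) (A z t))).
have := certificate_ge0.
suff -> : avg5 w (rel_on_5 certificate A) =
    225%:R * mean5 (fun _ _ _ _ _ => 1) + (- 1800%:R) * mean5 F0
    + (- 4%:R) * mean5 F1 + (- 4%:R) * mean5 F2
    + (-1) * mean5 (G1 flag_mix) + (- 35%:R) * mean5 (G1 flag_single)
    + (- 36%:R) * mean5 (G1 flag_triangle)
    + (- 48%:R) * mean5 (G3 (flag_diff 5 2)) + (- 348%:R) * mean5 (G3 (flag_diff 0 1))
    + (- 24%:R) * mean5 (G3 (flag_none (-2) 6 5))
    + (- 60%:R) * mean5 (G3 (flag_none 1 (-2) 0))
    + (- 24%:R) * mean5 (G3 (flag_none 1 (-3) 0)).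
  have -> : mean5 (fun _ _ _ _ _ => 1) = 1 by rewrite /mean5 !mean_cst.
  rewrite F0E F1E F2E.
  have := (G1_ge0 flag_mix, G1_ge0 flag_single, G1_ge0 flag_triangle,
    (G3_ge0 (flag_diff 5 2), G3_ge0 (flag_diff 0 1)), (G3_ge0 (flag_none (-2) 6 5),
     G3_ge0 (flag_none 1 (-2) 0), G3_ge0 (flag_none 1 (-3) 0))).
  case=> [[[[? ?] ?] [? ?]] [[? ?] ?]]; lra.
rewrite -!mean5Z -!mean5D; apply: eq_mean5 => x0 x1 x2 x3 x4.
have zE k : zcast R (Z.of_nat k) = k%:R.
  by rewrite /zcast (_ : int_of_Z _ = k%:Z) ?pmulrn //; lia.
rewrite /certificate /sos1 /sos3 /F0 /F1 /F2 /G1 /G3 /adjr /nadjr.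
(* The flags are generalised: the identity holds for arbitrary flag functions, and their case
   analyses stay folded. *)
move: flag_mix flag_single flag_triangle (flag_diff 5 2) (flag_diff 0 1)
  (flag_none (-2) 6 5) (flag_none 1 (-2) 0) (flag_none 1 (-3) 0) edge_type.
move=> l0 l1 l2 l3 l4 l5 l6 l7 s.
rewrite !(zcastB, zcastD, zcast_if, zcastM).
rewrite -[225%Z]/(Z.of_nat 225) -[1800%Z]/(Z.of_nat 1800) -[4%Z]/(Z.of_nat 4)
  -[35%Z]/(Z.of_nat 35) -[36%Z]/(Z.of_nat 36) -[48%Z]/(Z.of_nat 48)
  -[348%Z]/(Z.of_nat 348) -[24%Z]/(Z.of_nat 24) -[60%Z]/(Z.of_nat 60) !zE.
rewrite /copattern /far_pair.
have bM (b c : bool) : (b && c)%:R = b%:R * c%:R :> R by rewrite -natrM mulnb.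
rewrite !bM; ring.
Qed.

End FlagBound.

(** * The copattern density in terms of degrees and edge deficits *)

Section EdgeIdentity.

Variables (R : realFieldType) (V : finType) (w : R) (A : rel V).
Hypothesis A_sym : symmetric A.

Local Notation "'\E_' x F" := (avg w (fun x : V => F))
  (at level 41, x name, F at level 41).
Local Notation N := (\E__ 1).
Local Notation a := (adjr R A).
Local Notation b := (nadjr R A).
Local Notation d := (mdeg w A).
Local Notation c := (mcodeg w A).
Local Notation e := (mfar w A).

Lemma adjr_sym x y : a x y = a y x.
Proof. by rewrite /adjr A_sym. Qed.

Lemma nadjrE x y : b x y = 1 - a x y.
Proof. by rewrite /nadjr /adjr; case: (A x y); rewrite ?subrr ?subr0. Qed.

Lemma mcodegC x y : c x y = c y x.
Proof. by apply: eq_avg => z; rewrite mulrC. Qed.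

Lemma mfarE x y : e x y = N - d x - d y + c x y.
Proof.
rewrite -!avgB -avgD; apply: eq_avg => z.
by rewrite !nadjrE; ring.
Qed.

Definition edge_avg (f : V -> V -> R) := \E_x \E_y a x y * f x y.

Lemma eq_edge_avg f g : (forall x y, f x y = g x y) -> edge_avg f = edge_avg g.
Proof. by move=> fg; apply: eq_avg => x; apply: eq_avg => y; rewrite fg. Qed.

Lemma edge_avgD f g : edge_avg (fun x y => f x y + g x y) = edge_avg f + edge_avg g.
Proof.
rewrite /edge_avg -avgD; apply: eq_avg => x; rewrite -avgD; apply: eq_avg => y.
exact: mulrDr.
Qed.

Lemma edge_avgZ k f : edge_avg (fun x y => k * f x y) = k * edge_avg f.
Proof.
rewrite /edge_avg -avgZ; apply: eq_avg => x; rewrite -avgZ; apply: eq_avg => y.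
exact: mulrCA.
Qed.

Lemma edge_avgN f : edge_avg (fun x y => - f x y) = - edge_avg f.
Proof.
by rewrite -mulN1r -edge_avgZ; apply: eq_edge_avg => x y; rewrite mulN1r.
Qed.

Lemma edge_avgC f : edge_avg (fun x y => f y x) = edge_avg f.
Proof.
rewrite /edge_avg exchange_avg; apply: eq_avg => x; apply: eq_avg => y.
by rewrite adjr_sym.
Qed.

Lemma edge_avg_l f : edge_avg (fun x _ => f x) = \E_x d x * f x.
Proof. by apply: eq_avg => x; rewrite avgZr. Qed.

Lemma edge_avg_r f : edge_avg (fun _ y => f y) = \E_x d x * f x.
Proof. by rewrite -edge_avgC edge_avg_l. Qed.

Definition far_degree x y := \E_z b x z * b y z * d z.

(** Expanding [b = 1 - a] leaves the total degree, two sums over paths and a sum over triangles; in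
    the last one the weight is moved to another corner. *)
Lemma edge_avg_far_degree : edge_avg far_degree =
  (\E_x d x) ^+ 2 - 2%:R * edge_avg (fun x y => d x * d y)
  + edge_avg (fun x y => c x y * d x).
Proof.
pose s x := \E_z a x z * d z.
have sE : edge_avg (fun x y => s x) = edge_avg (fun x y => d x * d y).
  rewrite edge_avg_l; apply: eq_avg => x; rewrite -avgZ; apply: eq_avg => y; ring.
pose t x y := \E_z a x z * a y z * d z.
have tE : edge_avg t = edge_avg (fun x y => c x y * d x).
  transitivity (\E_z \E_x \E_y a x y * (a x z * a y z * d z)).
    rewrite exchange_avg; apply: eq_avg => x; rewrite exchange_avg.
    by apply: eq_avg => y; rewrite avgZ.
  apply: eq_avg => z; apply: eq_avg => x; rewrite -avgZr -avgZ; apply: eq_avg => y.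
  by rewrite (adjr_sym z x) (adjr_sym z y); ring.
have -> : edge_avg far_degree = edge_avg (fun x y => (\E_x d x) * 1
    + - s x + - s y + t x y).
  apply: eq_edge_avg => x y; rewrite mulr1 -!avgB -avgD; apply: eq_avg => z.
  by rewrite !nadjrE; ring.
rewrite 3!edge_avgD edge_avgZ !edge_avgN (edge_avgC (fun x _ => s x)) sE tE.
rewrite (edge_avg_l (fun=> 1)); under [X in _ * X]eq_avg do rewrite mulr1.
by ring.
Qed.

(** From all pairs of non-neighbours of [x] the adjacent ones are removed; counting these from the
    edge they form yields [far_degree]. *)
Lemma copattern_densityE : copattern_density w A =
  (\E_x d x * (N - d x) ^+ 2) - edge_avg far_degree.
Proof.
have -> : edge_avg far_degree = \E_x d x * \E_y \E_z b x y * b x z * a y z.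
  transitivity (\E_z \E_x \E_y a x y * (b x z * b y z * d z)).
    rewrite exchange_avg; apply: eq_avg => x; rewrite exchange_avg.
    by apply: eq_avg => y; rewrite avgZ.
  apply: eq_avg => x; rewrite -avgZ; apply: eq_avg => y; rewrite -avgZ.
  by apply: eq_avg => z; rewrite !nadjrE (adjr_sym y x) (adjr_sym z x); ring.
rewrite -avgB; apply: eq_avg => x; rewrite -mulrBr; congr (_ * _).
have -> : N - d x = \E_y b x y.
  by rewrite -avgB; apply: eq_avg => y; rewrite nadjrE.
rewrite expr2 -avgZr -avgB; apply: eq_avg => y; rewrite -avgZ -avgB.
by apply: eq_avg => z; rewrite (nadjrE y z); ring.
Qed.

Definition edge_deficit x y :=
  far_degree x y - e x y ^+ 2 + c x y * (N - c x y) / 2%:R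
  + 3%:R * (e x y * c x y) / 2%:R.

(* For a complete bipartite graph the deficit vanishes, as no vertex is adjacent
   to both or to none of the ends of an edge. *)
Theorem copattern_density_deficit : copattern_density w A =
  ((\E_x d x) * (N ^+ 2 - \E_x d x) - edge_avg edge_deficit) / 2%:R.
Proof.
(* With [e = N - d x - d y + c] the terms in [c ^ 2] cancel, and [c] survives only with the factor
   [(d x + d y) / 2]. *)
have -> : edge_avg edge_deficit = edge_avg (fun x y => far_degree x y
    + (- N ^+ 2) * 1 + 2%:R * N * d x + 2%:R * N * d y + (-1) * d x ^+ 2
    + (-1) * d y ^+ 2 + (- 2%:R) * (d x * d y) + 2%:R^-1 * (c x y * d x)
    + 2%:R^-1 * (c y x * d y)).
  by apply: eq_edge_avg => x y; rewrite /edge_deficit (mcodegC y x) mfarE; field.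
rewrite !edge_avgD !edge_avgZ (edge_avgC (fun x y => c x y * d x)).
rewrite (edge_avgC (fun x y => d x)) (edge_avgC (fun x y => d x ^+ 2)) !edge_avg_l.
rewrite copattern_densityE edge_avg_far_degree.
have -> : \E_x d x * (N - d x) ^+ 2 =
    N ^+ 2 * (\E_x d x) - 2%:R * N * (\E_x d x * d x) + \E_x d x * d x ^+ 2.
  by move: N => n; rewrite -!avgZ -avgB -avgD; apply: eq_avg => x; ring.
have -> : \E_x d x * 1 = \E_x d x by apply: eq_avg => x; rewrite mulr1.
have -> : \E_x d x * d x ^+ 2 = \E_x d x ^+ 3 by apply: eq_avg => x; ring.
by field.
Qed.

Hypotheses (w_ge0 : 0 <= w).

Lemma adjr_ge0 x y : 0 <= a x y. Proof. exact: ler0n. Qed.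
Lemma nadjr_ge0 x y : 0 <= b x y. Proof. exact: ler0n. Qed.
Lemma adjr_le1 x y : a x y <= 1. Proof. by rewrite lern1 leq_b1. Qed.

Lemma mdeg_ge0 x : 0 <= d x.
Proof. by apply: avg_ge0 => // y; exact: adjr_ge0. Qed.

Lemma mdeg_le x : d x <= N.
Proof. by apply: le_avg => // y; exact: adjr_le1. Qed.

Lemma mfar_ge0 x y : 0 <= e x y.
Proof. by apply: avg_ge0 => // z; rewrite mulr_ge0 ?nadjr_ge0. Qed.

Lemma mcodeg_ge0 x y : 0 <= c x y.
Proof. by apply: avg_ge0 => // z; rewrite mulr_ge0 ?adjr_ge0. Qed.

Lemma mcodeg_lel x y : c x y <= d x.
Proof. by apply: le_avg => // z; rewrite ler_piMr ?adjr_ge0 ?adjr_le1. Qed.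

Lemma far_degree_ge0 x y : 0 <= far_degree x y.
Proof.
by apply: avg_ge0 => // z; rewrite mulr_ge0 ?mdeg_ge0 // mulr_ge0 ?nadjr_ge0.
Qed.

Lemma edge_avg_ge0 f : (forall x y, 0 <= f x y) -> 0 <= edge_avg f.
Proof.
move=> f0; do 2!apply: avg_ge0 => // ?.
by rewrite mulr_ge0 ?adjr_ge0.
Qed.

Lemma le_edge_avg f g : (forall x y, f x y <= g x y) -> edge_avg f <= edge_avg g.
Proof. by move=> fg; do 2!apply: le_avg => // ?; rewrite ler_wpM2l ?adjr_ge0. Qed.

(** The deficit is at least [- e ^ 2], so [(1/2 - D) ^ 2 <= 2 (1/8 - p) + K1] for the mean degree
    [D] and the density [p]; by the flag bound the right side is at most [452 (1/8 - p)]. *)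
Theorem degree_concentration t : N = 1 -> 0 < t <= 1 ->
  452%:R * (8%:R^-1 - copattern_density w A) <= t ^+ 2 ->
  \E_x (d x - 2%:R^-1) ^+ 2 <= t.
Proof.
move=> N1 /andP[t0 t1] dens_near.
have := flag_bound w_ge0 N1 A_sym.
rewrite -/(edge_avg (fun x y => e x y ^+ 2)) -/(edge_avg c).
set K1 := edge_avg _; set K2 := edge_avg _ => bound.
have K10 : 0 <= K1 by apply: edge_avg_ge0 => x y; exact: sqr_ge0.
have K20 : 0 <= K2 by apply: edge_avg_ge0 => x y; exact: mcodeg_ge0.
have deficit : - K1 <= edge_avg edge_deficit.
  rewrite -edge_avgN; apply: le_edge_avg => x y.
  have c0 := mcodeg_ge0 x y; have cl := mcodeg_lel x y; have dl := mdeg_le x.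
  have e0 := mfar_ge0 x y; have W0 := far_degree_ge0 x y.
  rewrite /edge_deficit; have : 0 <= c x y * (N - c x y) by rewrite mulr_ge0 //; lra.
  have : 0 <= e x y * c x y by rewrite mulr_ge0.
  lra.
have densE := copattern_density_deficit; rewrite N1 in densE.
set D := \E_x d x in densE.
(* As the left side is nonnegative, this bounds the second moment of the degrees by
   [(D + K2) / 2]. *)
have far_eq : edge_avg e = D - 2%:R * (\E_x d x * d x) + K2.
  have -> : edge_avg e = edge_avg (fun x y => N * 1 + (-1) * d x + (-1) * d y + c x y).
    by apply: eq_edge_avg => x y; rewrite mfarE; ring.
  rewrite !edge_avgD !edge_avgZ edge_avg_l (edge_avg_l d) (edge_avg_r d) N1.
  have -> : \E_x d x * 1 = D by apply: eq_avg => x; rewrite mulr1.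
  by rewrite -/K2; ring.
have far0 : 0 <= edge_avg e by apply: edge_avg_ge0 => x y; exact: mfar_ge0.
have Dsq : (2%:R^-1 - D) ^+ 2 <= t ^+ 2.
  suff : (2%:R^-1 - D) ^+ 2 = 4%:R^-1 - D * (1 - D) by lra.
  by field.
have Dt : 2%:R^-1 - D <= t.
  by rewrite leNgt; apply/negP => h; move: Dsq; rewrite !expr2; nra.
have t2 : t ^+ 2 <= t by rewrite expr2 ler_piMr // ltW.
have -> : \E_x (d x - 2%:R^-1) ^+ 2 = (\E_x d x * d x) - D + 4%:R^-1 * N.
  by rewrite -avg_cst -avgB -avgD; apply: eq_avg => x; field.
rewrite N1; lra.
Qed.

End EdgeIdentity.

(** * Multilinear forms in vertex weights *)

Section WeightedSums.

Variables (R : realFieldType) (V : finType).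
Implicit Types (m p : V -> R) (h : V -> R) (g : V -> V -> V -> V -> R).

Definition wsum m h := \sum_x m x * h x.

Lemma eq_wsum m h h' : h =1 h' -> wsum m h = wsum m h'.
Proof. by move=> hh; apply: eq_bigr => x _; rewrite hh. Qed.

Lemma wsumDl m p h : wsum (fun x => m x + p x) h = wsum m h + wsum p h.
Proof. by rewrite -big_split; apply: eq_bigr => x _; rewrite mulrDl. Qed.

Lemma wsumDr m h h' : wsum m (fun x => h x + h' x) = wsum m h + wsum m h'.
Proof. by rewrite -big_split; apply: eq_bigr => x _; rewrite mulrDr. Qed.

Lemma norm_wsum m h C : (forall x, `|h x| <= C) -> `|wsum m h| <= (\sum_x `|m x|) * C.
Proof.
move=> hC; rewrite (le_trans (ler_norm_sum _ _ _)) // mulr_suml ler_sum // => x _.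
by rewrite normrM ler_wpM2l.
Qed.

Lemma wsum_cst w h : wsum (fun=> w) h = avg w h.
Proof. by rewrite avgE mulr_sumr. Qed.

Definition form4 g m0 m1 m2 m3 :=
  wsum m0 (fun x => wsum m1 (fun y => wsum m2 (fun z => wsum m3 (g x y z)))).

Lemma form4D0 g m p m1 m2 m3 : form4 g (fun x => m x + p x) m1 m2 m3 =
  form4 g m m1 m2 m3 + form4 g p m1 m2 m3.
Proof. exact: wsumDl. Qed.

Lemma form4D1 g m p m0 m2 m3 : form4 g m0 (fun x => m x + p x) m2 m3 =
  form4 g m0 m m2 m3 + form4 g m0 p m2 m3.
Proof. by rewrite -wsumDr; apply: eq_wsum => x; exact: wsumDl. Qed.

Lemma form4D2 g m p m0 m1 m3 : form4 g m0 m1 (fun x => m x + p x) m3 =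
  form4 g m0 m1 m m3 + form4 g m0 m1 p m3.
Proof.
rewrite -wsumDr; apply: eq_wsum => x; rewrite -wsumDr; apply: eq_wsum => y.
exact: wsumDl.
Qed.

Lemma form4D3 g m p m0 m1 m2 : form4 g m0 m1 m2 (fun x => m x + p x) =
  form4 g m0 m1 m2 m + form4 g m0 m1 m2 p.
Proof.
rewrite -wsumDr; apply: eq_wsum => x; rewrite -wsumDr; apply: eq_wsum => y.
by rewrite -wsumDr; apply: eq_wsum => z; exact: wsumDl.
Qed.

Lemma norm_form4 g m0 m1 m2 m3 : (forall x y z t, `|g x y z t| <= 1) ->
  `|form4 g m0 m1 m2 m3| <= (\sum_x `|m0 x|) * ((\sum_x `|m1 x|) *
    ((\sum_x `|m2 x|) * (\sum_x `|m3 x|))).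
Proof.
move=> g1; do 3!apply: norm_wsum => ?.
by rewrite -[leRHS]mulr1; apply: norm_wsum.
Qed.

Lemma norm_form4_le g m0 m1 m2 m3 k0 k1 k2 k3 : (forall x y z t, `|g x y z t| <= 1) ->
  \sum_x `|m0 x| <= k0 -> \sum_x `|m1 x| <= k1 -> \sum_x `|m2 x| <= k2 ->
  \sum_x `|m3 x| <= k3 -> `|form4 g m0 m1 m2 m3| <= k0 * (k1 * (k2 * k3)).
Proof.
move=> g1 h0 h1 h2 h3; apply: le_trans (norm_form4 _ _ _ _ g1) _.
have s0 (m : V -> R) : 0 <= \sum_x `|m x| by rewrite sumr_ge0.
by do 3!(apply: ler_pM => //; rewrite ?mulr_ge0 //).
Qed.

End WeightedSums.

(** * Cloning a vertex as a shift of weight *)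

Section Cloning.

Variables (R : realFieldType) (V : finType) (w : R) (u v : V).
Hypotheses (w_ge0 : 0 <= w) (w_le1 : w <= 1) (w_mean : avg w (fun _ : V => 1) = 1).

Local Notation "'\E_' x F" := (avg w (fun x : V => F))
  (at level 41, x name, F at level 41).

Definition clone x := if x == v then u else x.
(** Replacing [v] by a clone of [u] moves the weight [w] of [v] to [u]; this is the resulting change
    of the weight function. *)
Definition mass_shift x : R := w * ((x == u)%:R - (x == v)%:R).

Lemma wsum_indicator (x : V) h : wsum (fun y => (y == x)%:R) h = h x :> R.
Proof.
rewrite /wsum (bigD1 x) //= eqxx mul1r big1 ?addr0 // => y /negPf->.
by rewrite mul0r.
Qed.

Lemma wsum_mass_shift h : wsum mass_shift h = w * (h u - h v).
Proof.
rewrite -(wsum_indicator u h) -(wsum_indicator v h) /wsum -sumrB mulr_sumr.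
by apply: eq_bigr => x _; rewrite /mass_shift; ring.
Qed.

Lemma sum_mass_shift : \sum_x `|mass_shift x| <= 2%:R * w.
Proof.
apply: (le_trans (y := \sum_x (w * (x == u)%:R + w * (x == v)%:R))).
  apply: ler_sum => x _; rewrite /mass_shift normrM ger0_norm // -mulrDr ler_wpM2l //.
  by rewrite (le_trans (ler_normB _ _)) // !normr_nat.
rewrite big_split /= -!mulr_sumr.
have one x : \sum_(y : V) (y == x)%:R = 1 :> R.
  by rewrite (bigD1 x) //= eqxx big1 ?addr0 // => y /negPf->.
by rewrite !one; lra.
Qed.

Lemma sum_cst : \sum_(x : V) `|w| <= 1.
Proof.
have := w_mean; rewrite avgE ger0_norm // -[in X in _ -> X](mulr1 w) -mulr_sumr.
by move=> ->.
Qed.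

Lemma avg_clone h : \E_x h (clone x) = wsum (fun x => w + mass_shift x) h.
Proof.
rewrite wsumDl wsum_cst wsum_mass_shift !avgE -mulrDr; congr (_ * _).
rewrite (bigD1 v) //= [in RHS](bigD1 v) //= /clone eqxx.
rewrite (eq_bigr h); last by move=> x /negPf->.
by ring.
Qed.

Lemma avg4_clone g : \E_x \E_y \E_z \E_t g (clone x) (clone y) (clone z) (clone t) =
  let m x := w + mass_shift x in form4 g m m m m.
Proof.
rewrite /form4 /= -avg_clone; apply: eq_avg => x.
rewrite -(avg_clone (fun y => wsum _ (fun z => wsum _ (g (clone x) y z)))).
apply: eq_avg => y.
rewrite -(avg_clone (fun z => wsum _ (g (clone x) (clone y) z))).
by apply: eq_avg => z; rewrite -avg_clone.
Qed.

Definition form4_linear g : R := let m := fun=> w in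
  form4 g mass_shift m m m + form4 g m mass_shift m m + form4 g m m mass_shift m
  + form4 g m m m mass_shift.

(** Six terms with two shifts, four with three and one with four remain. A shift has total mass at
    most [2 w], and [w <= 1], whence [6 * 4 + 4 * 8 + 16 = 72]. *)
Lemma avg4_clone_second_order g : (forall x y z t, `|g x y z t| <= 1) ->
  `|(\E_x \E_y \E_z \E_t g (clone x) (clone y) (clone z) (clone t))
    - (\E_x \E_y \E_z \E_t g x y z t) - form4_linear g| <= 72%:R * w ^+ 2.
Proof.
move=> g1; rewrite avg4_clone /=.
have -> : \E_x \E_y \E_z \E_t g x y z t =
    form4 g (fun=> w) (fun=> w) (fun=> w) (fun=> w).
  rewrite /form4 wsum_cst; apply: eq_avg => x; rewrite wsum_cst; apply: eq_avg => y.
  by rewrite wsum_cst; apply: eq_avg => z; rewrite wsum_cst.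
rewrite !form4D0 !form4D1 !form4D2 !form4D3 /form4_linear /=.
have bd m0 m1 m2 m3 k0 k1 k2 k3 := @norm_form4_le _ _ g m0 m1 m2 m3 k0 k1 k2 k3 g1.
have sc := sum_cst; have ss := sum_mass_shift.
have := bd _ _ _ _ _ _ _ _ ss ss sc sc; have := bd _ _ _ _ _ _ _ _ ss sc ss sc.
have := bd _ _ _ _ _ _ _ _ ss sc sc ss; have := bd _ _ _ _ _ _ _ _ sc ss ss sc.
have := bd _ _ _ _ _ _ _ _ sc ss sc ss; have := bd _ _ _ _ _ _ _ _ sc sc ss ss.
have := bd _ _ _ _ _ _ _ _ ss ss ss sc; have := bd _ _ _ _ _ _ _ _ ss ss sc ss.
have := bd _ _ _ _ _ _ _ _ ss sc ss ss; have := bd _ _ _ _ _ _ _ _ sc ss ss ss.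
have := bd _ _ _ _ _ _ _ _ ss ss ss ss.
have w3 : w ^+ 3 <= w ^+ 2 by rewrite exprS ler_piMl ?sqr_ge0.
have w4 : w ^+ 4 <= w ^+ 2 by rewrite exprS (le_trans _ w3) // ler_piMl ?exprn_ge0.
rewrite !ler_norml; move=> *; apply/andP; split; lra.
Qed.

End Cloning.

(** * Roles of a vertex in copatterns, and the degree dichotomy *)

Section Roles.

Variables (R : realFieldType) (V : finType) (w : R) (A : rel V).
Hypotheses (w_gt0 : 0 < w) (w_le1 : w <= 1) (w_mean : avg w (fun _ : V => 1) = 1).
Hypothesis A_sym : symmetric A.

Local Notation "'\E_' x F" := (avg w (fun x : V => F))
  (at level 41, x name, F at level 41).
Local Notation a := (adjr R A).
Local Notation b := (nadjr R A).
Local Notation d := (mdeg w A).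
Local Notation bb := (mcoindep w A).

Let w_ge0 : 0 <= w := ltW w_gt0.

(* The embedding (x, y, z, t) sends 0, 1, 3 to x, y, z and 2 to t. *)
Definition copat (B : rel V) x y z t : R :=
  adjr R B x t * (nadjr R B x y * nadjr R B x z * nadjr R B y z).
Definition cherry (B : rel V) x y (z t : V) : R := adjr R B x t * nadjr R B x y.
Definition ends (B : rel V) x (y z t : V) : R := adjr R B x t.

Definition mean4 (g : V -> V -> V -> V -> R) := \E_x \E_y \E_z \E_t g x y z t.

(* The correction terms account for coincidences between x, y and z. *)
Definition normalized_count (B : rel V) :=
  mean4 (copat B) - 3%:R * w * mean4 (cherry B) + 2%:R * w ^+ 2 * mean4 (ends B).

Lemma mean4_copat : mean4 (copat A) = copattern_density w A.
Proof.
apply: eq_avg => x; rewrite mulrC -avgZr; apply: eq_avg => y.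
by rewrite -avgZr; apply: eq_avg => z; rewrite avgZr mulrC.
Qed.

Lemma copat_norm x y z t : `|copat A x y z t| <= 1.
Proof. by rewrite /copat /adjr /nadjr -!natrM normr_nat lern1 !mulnb leq_b1. Qed.

Lemma cherry_norm x y z t : `|cherry A x y z t| <= 1.
Proof. by rewrite /cherry /adjr /nadjr -!natrM normr_nat lern1 !mulnb leq_b1. Qed.

Lemma mean4_ge0 g : (forall x y z t, 0 <= g x y z t) -> 0 <= mean4 g.
Proof. by move=> g0; do 4!apply: avg_ge0 => // ?. Qed.

Lemma mean4_le1 g : (forall x y z t, g x y z t <= 1) -> mean4 g <= 1.
Proof.
move=> g1; rewrite -[leRHS](mean_cst w_mean) -[X in \E__ X](mean_cst w_mean).
rewrite -[X in \E__ \E__ X](mean_cst w_mean) -[X in \E__ \E__ \E__ X](mean_cst w_mean).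
by do 4!apply: le_avg => // ?.
Qed.

Definition cloned u v : rel V := fun x y => A (clone u v x) (clone u v y).

(** This is the derivative of the copattern density in the weight of [x], with one summand for each
    position. *)
Definition role_sum x :=
  (\E_y \E_z \E_t copat A x y z t) + (\E_y \E_z \E_t copat A y x z t)
  + (\E_y \E_z \E_t copat A y z x t) + (\E_y \E_z \E_t copat A y z t x).

Lemma form4_linear_roles u v :
  form4_linear w u v (copat A) = w * (role_sum u - role_sum v).
Proof.
rewrite /form4_linear /form4 /= wsum_mass_shift.
have cE k h : \sum_(x : V) k * h x = k * \sum_x h x :> R by rewrite mulr_sumr.
have shE (h : V -> V -> R) : wsum (fun=> w) (fun x => wsum (mass_shift w u v) (h x)) =
    w * ((\E_x h x u) - \E_x h x v).
  by rewrite wsum_cst -avgB -avgZ; apply: eq_avg => x; rewrite wsum_mass_shift.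
have wE (h : V -> R) : wsum (fun=> w) h = \E_x h x := wsum_cst w h.
rewrite shE.
have -> : wsum (fun=> w) (fun x => wsum (fun=> w) (fun y => wsum (mass_shift w u v)
    (fun z => wsum (fun=> w) (copat A x y z)))) =
    w * ((\E_x \E_y wsum (fun=> w) (copat A x y u))
         - \E_x \E_y wsum (fun=> w) (copat A x y v)).
  rewrite wE -avgB -avgZ; apply: eq_avg => x.
  by rewrite (shE (fun y z => wsum (fun=> w) (copat A x y z))).
have -> : wsum (fun=> w) (fun x => wsum (fun=> w) (fun y => wsum (fun=> w)
    (fun z => wsum (mass_shift w u v) (copat A x y z)))) =
    w * ((\E_x \E_y \E_z copat A x y z u) - \E_x \E_y \E_z copat A x y z v).
  rewrite wE -avgB -avgZ; apply: eq_avg => x; rewrite wE -avgB -avgZ.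
  by apply: eq_avg => y; rewrite shE.
have w3E (h : V -> V -> V -> R) : wsum (fun=> w) (fun y => wsum (fun=> w)
    (fun z => wsum (fun=> w) (h y z))) = \E_y \E_z \E_t h y z t.
  by rewrite wE; apply: eq_avg => y; rewrite wE; apply: eq_avg => z; rewrite wE.
have w1E (h : V -> V -> V -> R) : (\E_x \E_y wsum (fun=> w) (h x y)) =
    \E_x \E_y \E_z h x y z.
  by apply: eq_avg => x; apply: eq_avg => y; rewrite wE.
have w2E (h : V -> V -> V -> R) : (\E_x wsum (fun=> w) (fun y => wsum (fun=> w) (h x y)))
    = \E_x \E_y \E_z h x y z.
  by apply: eq_avg => x; rewrite wE; apply: eq_avg => y; rewrite wE.
rewrite !w3E (w1E (fun x y => copat A x y u)) (w1E (fun x y => copat A x y v)).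
rewrite (w2E (fun x => copat A x u)) (w2E (fun x => copat A x v)) /role_sum; ring.
Qed.

(* To first order in w, turning v into a clone of u changes the normalized count
   by w times the difference of the role sums. *)
Lemma clone_gain u v : normalized_count (cloned u v) <= normalized_count A ->
  role_sum u - role_sum v <= 314%:R * w.
Proof.
move=> opt; rewrite -(ler_pM2l w_gt0) -form4_linear_roles mulrCA -expr2.
have := avg4_clone_second_order u v w_ge0 w_le1 w_mean copat_norm.
have := avg4_clone_second_order u v w_ge0 w_le1 w_mean cherry_norm.
rewrite -!/(mean4 _).
set lk := form4_linear _ _ _ (cherry A).
have lk8 : `|lk| <= 8%:R * w.
  have sc := sum_cst w_ge0 w_mean; have ss := sum_mass_shift u v w_ge0.
  have bd m0 m1 m2 m3 k0 k1 k2 k3 :=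
    @norm_form4_le _ _ _ m0 m1 m2 m3 k0 k1 k2 k3 cherry_norm.
  have := bd _ _ _ _ _ _ _ _ ss sc sc sc; have := bd _ _ _ _ _ _ _ _ sc ss sc sc.
  have := bd _ _ _ _ _ _ _ _ sc sc ss sc; have := bd _ _ _ _ _ _ _ _ sc sc sc ss.
  rewrite /lk /form4_linear !ler_norml; move=> *; apply/andP; split; lra.
move: opt; rewrite /normalized_count.
rewrite -[mean4 (copat (cloned u v))]/(mean4 (fun x y z t =>
  copat A (clone u v x) (clone u v y) (clone u v z) (clone u v t))).
rewrite -[mean4 (cherry (cloned u v))]/(mean4 (fun x y z t =>
  cherry A (clone u v x) (clone u v y) (clone u v z) (clone u v t))).
set C' := mean4 (fun x y z t => copat A _ _ _ _); set C := mean4 (copat A).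
set K' := mean4 (fun x y z t => cherry A _ _ _ _); set K := mean4 (cherry A).
have e0 : 0 <= mean4 (ends (cloned u v)).
  by apply: mean4_ge0 => x y z t; exact: ler0n.
have e1 : mean4 (ends A) <= 1.
  by apply: mean4_le1 => x y z t; rewrite lern1 leq_b1.
move: e0 e1; set e0 := mean4 _; set e1 := mean4 _ => e0_ge0 e1_le1 opt.
move: lk8; rewrite !ler_norml => /andP[lk1 lk2] /andP[k1 k2] /andP[c1 c2].
have w2 : 0 <= w ^+ 2 by exact: sqr_ge0.
have w3 : w * w ^+ 2 <= w ^+ 2 by rewrite ler_piMl.
(* Here [80 = 8 + 72], linear part plus remainder. The final constant is [314 = 72 + 3 * 80 + 2]:
   the remainder for [copat], the cherry correction and the ends correction. *)
have kk : w * (K' - K) <= 80%:R * w ^+ 2.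
  have -> : 80%:R * w ^+ 2 = w * (80%:R * w) by ring.
  have : w ^+ 2 <= w by rewrite expr2 ler_piMl.
  by move=> ?; rewrite ler_wpM2l //; lra.
have ee0 : 0 <= w ^+ 2 * e0 by rewrite mulr_ge0.
have ee1 : w ^+ 2 * e1 <= w ^+ 2 by rewrite ler_piMr.
lra.
Qed.

Lemma mean_role_sum : \E_x role_sum x = 4%:R * copattern_density w A.
Proof.
rewrite /role_sum !avgD -mean4_copat.
have -> : \E_x \E_y \E_z \E_t copat A y x z t = mean4 (copat A).
  by rewrite exchange_avg.
have -> : \E_x \E_y \E_z \E_t copat A y z x t = mean4 (copat A).
  by rewrite exchange_avg; apply: eq_avg => x; rewrite exchange_avg.
have -> : \E_x \E_y \E_z \E_t copat A y z t x = mean4 (copat A).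
  rewrite exchange_avg; apply: eq_avg => x; rewrite exchange_avg; apply: eq_avg => y.
  by rewrite exchange_avg.
by rewrite -/(mean4 (copat A)); ring.
Qed.

(** The clone gain is averaged over [u]; the mean role sum is four times the density, once for each
    position. *)
Lemma role_sum_lower v :
  (forall u, normalized_count (cloned u v) <= normalized_count A) ->
  4%:R * copattern_density w A - 314%:R * w <= role_sum v.
Proof.
move=> opt; have : \E_u role_sum u <= \E__ (role_sum v + 314%:R * w).
  by apply: le_avg => // u; have := clone_gain (opt u); lra.
by rewrite (mean_cst w_mean) mean_role_sum; lra.
Qed.

Definition mean_dev := \E_x `|d x - 2%:R^-1|.

Lemma mdeg_in01 x : 0 <= d x <= 1.
Proof. by rewrite mdeg_ge0 //= -w_mean mdeg_le. Qed.

Lemma mcoindepE x :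
  bb x = (1 - d x) ^+ 2 - \E_y \E_z b x y * b x z * a y z.
Proof.
have -> : 1 - d x = \E_y b x y.
  by rewrite -w_mean -avgB; apply: eq_avg => y; rewrite nadjrE.
rewrite expr2 -avgZr -avgB; apply: eq_avg => y; rewrite -avgZ -avgB.
by apply: eq_avg => z; rewrite (nadjrE _ _ y z); ring.
Qed.

Lemma mcoindep_le_sqr x : bb x <= (1 - d x) ^+ 2.
Proof.
rewrite mcoindepE gerBl; do 2!apply: avg_ge0 => // ?.
by rewrite !mulr_ge0 ?nadjr_ge0 ?adjr_ge0.
Qed.

(** The edges inside the non-neighbourhood of [x] make up at least the total degree minus twice the
    degree sum over the neighbours of [x]; with most degrees near [1/2] this is about
    [1/2 - d x]. *)
Lemma mcoindep_le x : bb x <= 2%:R^-1 - d x + d x ^+ 2 + 3%:R * mean_dev.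
Proof.
rewrite mcoindepE.
suff : 2%:R^-1 - d x - 3%:R * mean_dev <= \E_y \E_z b x y * b x z * a y z by lra.
apply: (le_trans (y := \E_y (d y - a x y * d y - \E_z a x z * a z y))); last first.
  apply: le_avg => // y; rewrite -avgZ -!avgB; apply: le_avg => // z.
  rewrite !nadjrE (adjr_sym R A_sym z y).
  have : 0 <= a x y * a x z * a y z by rewrite !mulr_ge0 ?adjr_ge0.
  lra.
have -> : \E_y (d y - a x y * d y - \E_z a x z * a z y) =
    (\E_y d y) - 2%:R * \E_y a x y * d y.
  rewrite !avgB exchange_avg.
  under [X in _ - _ - X]eq_avg do rewrite avgZ.
  ring.
have dev1 : 2%:R^-1 - mean_dev <= \E_y d y.
  rewrite -[2%:R^-1](mean_cst w_mean) -avgB; apply: le_avg => // y.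
  by have := ler_norm (- (d y - 2%:R^-1)); rewrite normrN; lra.
have dev2 : \E_y a x y * d y <= 2%:R^-1 * d x + mean_dev.
  rewrite -avgZ -avgD; apply: le_avg => // y.
  have h := ler_norm (d y - 2%:R^-1); have a1 := adjr_le1 R A x y.
  have a0 := adjr_ge0 R A x y.
  have : a x y * (d y - 2%:R^-1) <= `|d y - 2%:R^-1|.
    by rewrite (le_trans (ler_wpM2l a0 h)) // ler_piMl.
  lra.
lra.
Qed.

(** As most degrees are close to [1/2], position 0 contributes [d v * bb v], positions 1 and 3 at
    most about [bb v / 2] each, and position 2 at most about [d v / 4]. *)
Lemma role_sum_upper v :
  role_sum v <= (1 + d v) * bb v + d v / 4%:R + 4%:R * mean_dev.
Proof.
have r0 : \E_y \E_z \E_t copat A v y z t = d v * bb v.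
  rewrite mulrC -avgZr; apply: eq_avg => y; rewrite -avgZr; apply: eq_avg => z.
  by rewrite avgZr mulrC.
have r21 : \E_y \E_z \E_t copat A y z v t = \E_y \E_z \E_t copat A y v z t.
  apply: eq_avg => x; apply: eq_avg => y; apply: eq_avg => t; rewrite /copat.
  by rewrite !nadjrE (adjr_sym R A_sym y v); ring.
have r1 : \E_y \E_z \E_t copat A y v z t <= bb v / 2%:R + mean_dev.
  rewrite -avgZr -avgD; apply: le_avg => // x.
  have -> : \E_z \E_t copat A x v z t = d x * \E_z b v x * b v z * b x z.
    rewrite -avgZ; apply: eq_avg => z; rewrite avgZr -/(d x) !nadjrE (adjr_sym R A_sym v x).
    ring.
  set h := \E_z _; have h0 : 0 <= h.
    by apply: avg_ge0 => // z; rewrite !mulr_ge0 ?nadjr_ge0.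
  have h1 : h <= 1.
    rewrite -[leRHS](mean_cst w_mean); apply: le_avg => // z.
    by rewrite /nadjr -!natrM lern1 !mulnb leq_b1.
  have hd := ler_norm (d x - 2%:R^-1).
  have : h * (d x - 2%:R^-1) <= `|d x - 2%:R^-1|.
    by rewrite (le_trans (ler_wpM2l h0 hd)) // ler_piMl.
  lra.
have r3 : \E_y \E_z \E_t copat A y z t v <= d v / 4%:R + 2%:R * mean_dev.
  rewrite -avgZr -avgZ -avgD; apply: le_avg => // x.
  have -> : \E_z \E_t copat A x z t v = a v x * bb x.
    rewrite -avgZ; apply: eq_avg => z; rewrite -avgZ; apply: eq_avg => t.
    by rewrite /copat (adjr_sym R A_sym v x).
  have a0 := adjr_ge0 R A v x; have a1 := adjr_le1 R A v x.
  have /andP[d0 d1] := mdeg_in01 x.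
  have B : bb x <= 4%:R^-1 + 2%:R * `|d x - 2%:R^-1|.
    apply: le_trans (mcoindep_le_sqr x) _.
    have h1 := ler_norm (d x - 2%:R^-1); have h2 := ler_norm (- (d x - 2%:R^-1)).
    rewrite normrN in h2; rewrite expr2; set t := `|_| in h1 h2 *; nra.
  rewrite (le_trans (ler_wpM2l a0 B)) // mulrDr lerD2l.
  by rewrite mulrCA ler_wpM2l ?ler_piMl ?ler0n.
rewrite /role_sum r0 r21; lra.
Qed.

(** Up to [10 * mean_dev], the role sum of a vertex of degree [x] is at most
    [1/2 - x (1/2 - x) (1/2 + x)] by [mcoindep_le], and at most [1/2 - (x - 1/2) (1 + x/2 - x ^ 2)]
    by [mcoindep_le_sqr]. The first bound excludes degrees well between 0 and [1/2], the second
    those well above [1/2]. *)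
Theorem degree_dichotomy (eps s0 : R) v : 0 < eps <= 4%:R^-1 ->
  2%:R^-1 - s0 <= role_sum v -> s0 + 10%:R * mean_dev < eps / 8%:R ->
  d v <= eps \/ `|d v - 2%:R^-1| <= eps.
Proof.
move=> /andP[eps0 eps1] low small.
have := role_sum_upper v; have b1 := mcoindep_le_sqr v; have b2 := mcoindep_le v.
have /andP[d0 d1] := mdeg_in01 v; set x := d v in b1 b2 d0 d1 *.
have T0 : 0 <= mean_dev by apply: avg_ge0 => // y.
move: (bb v) (mean_dev) b1 b2 T0 small => B T b1 b2 T0 small up.
case: (lerP x eps) => [|xe]; [by left | right].
rewrite ler_norml; apply/andP; split.
  rewrite leNgt; apply/negP => h.
  have : (1 + x) * B <= (1 + x) * (2%:R^-1 - x + x ^+ 2 + 3%:R * T).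
    by rewrite ler_wpM2l //; lra.
  have xT : x * T <= T by rewrite ler_piMl.
  have : eps * (2%:R^-1 - eps) <= x * (2%:R^-1 - x) by nra.
  have : x * (2%:R^-1 - x) * 2%:R^-1 <= x * (2%:R^-1 - x) * (2%:R^-1 + x).
    by rewrite ler_wpM2l ?mulr_ge0 //; lra.
  have : eps * 4%:R^-1 <= eps * (2%:R^-1 - eps) by rewrite ler_wpM2l ?ltW //; lra.
  rewrite !expr2; nra.
rewrite leNgt; apply/negP => h.
have : (1 + x) * B <= (1 + x) * (1 - x) ^+ 2 by rewrite ler_wpM2l //; lra.
have : (x - 2%:R^-1) * 2%:R^-1 <= (x - 2%:R^-1) * (1 + x / 2%:R - x ^+ 2).
  by rewrite ler_wpM2l ?expr2 //; [lra | nra].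
rewrite !expr2; nra.
Qed.

Lemma mean_dev_le s : 0 < s -> \E_x (d x - 2%:R^-1) ^+ 2 <= s ^+ 2 ->
  mean_dev <= 2%:R * s.
Proof.
move=> s0 var; rewrite -(ler_pM2l s0).
have : \E_x s * `|d x - 2%:R^-1| <= \E_x (s ^+ 2 + (d x - 2%:R^-1) ^+ 2).
  apply: le_avg => // x; rewrite -[(d x - _) ^+ 2]real_normK ?num_real //.
  set t := `|_|; have := sqr_ge0 (s - t); have := sqr_ge0 s; have := sqr_ge0 t.
  by rewrite !expr2; nra.
by rewrite avgZ avgD (mean_cst w_mean); move: var; rewrite /mean_dev !expr2; lra.
Qed.

End Roles.

(** * Exact counts and odd triples *)

Section ExactCount.

Variables (R : realFieldType) (V : finType) (A : rel V).
Hypotheses (A_sym : symmetric A).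

Local Notation "'\S_' x F" := (avg 1 (fun x : V => F))
  (at level 41, x name, F at level 41).
Local Notation n := (avg 1 (fun _ : V => 1 : R)).
Local Notation a := (adjr R A).
Local Notation b := (nadjr R A).
Local Notation d := (mdeg (1 : R) A).
Local Notation c := (mcodeg (1 : R) A).
Local Notation e := (mfar (1 : R) A).
Local Notation M := (\S_x d x).
Local Notation edge_sum := (edge_avg (1 : R) A).

Let le01 : 0 <= 1 :> R := ler01.

(** The subtracted term removes the tuples with a coincidence among the three independent vertices;
    see [exact_count_copattern]. *)
Definition exact_count : R :=
  copattern_density 1 A - \S_x d x * (3%:R * (n - d x) - 2%:R).

Definition exact_deficit x y := edge_deficit 1 A x y + 3%:R * e x y + (- 3%:R) * c x y.

(** The coincidences bring in [n * M] minus twice the sum of the squared degrees, which is the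
    difference of the edge sums of [e] and [c]; hence the two extra terms of [exact_deficit]. *)
Lemma exact_countE : exact_count =
  (M * (n ^+ 2 - 3%:R * n + 4%:R - M) - edge_sum exact_deficit) / 2%:R.
Proof.
rewrite /exact_count copattern_density_deficit // !edge_avgD !edge_avgZ.
have -> : edge_sum e = n * M - 2%:R * (\S_x d x * d x) + edge_sum c.
  have -> : edge_sum e = edge_sum (fun x y => n * 1 + (-1) * d x + (-1) * d y + c x y).
    by apply: eq_edge_avg => x y; rewrite mfarE; ring.
  rewrite !edge_avgD !edge_avgZ edge_avg_l (edge_avg_l _ _ d) (edge_avg_r _ A_sym d).
  have -> : \S_x d x * 1 = M by apply: eq_avg => x; rewrite mulr1.
  by ring.
have -> : \S_x d x * (3%:R * (n - d x) - 2%:R) =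
    (3%:R * n - 2%:R) * M - 3%:R * (\S_x d x * d x).
  by move: n => k; rewrite -!avgZ -avgB; apply: eq_avg => x; ring.
by field.
Qed.

Definition odd_triple x y z := A x y (+) A x z (+) A y z.

(** Each of the six pairs lies in two of the four triples, so the number of odd triples among four
    vertices is even. *)
Lemma odd_triple4 x y z t : odd_triple x y z ->
  [|| odd_triple x y t, odd_triple x z t | odd_triple y z t].
Proof.
rewrite /odd_triple.
by case: (A x y); case: (A x z); case: (A y z); case: (A x t); case: (A y t);
  case: (A z t).
Qed.

(* A single odd triple forces linearly many: each further vertex lies in one. *)
Lemma odd_triple_edges (x y z : V) : irreflexive A -> odd_triple x y z ->
  n <= 3%:R * edge_sum (fun x y => e x y + c x y).
Proof.
move=> A_irr odd_xyz.
pose B p q : R := \S_t (odd_triple p q t)%:R.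
have nB : n <= B x y + B x z + B y z.
  rewrite -!avgD; apply: le_avg => // t; rewrite -!natrD ler1n.
  by have := odd_triple4 t odd_xyz; case: odd_triple; case: odd_triple => //=;
    case: odd_triple.
have oddC p q r : odd_triple p q r = odd_triple q p r.
  by rewrite /odd_triple (A_sym q p) -!addbA [A q r (+) _]addbC.
have odd_irr p r : odd_triple p p r = false.
  by rewrite /odd_triple A_irr addFb addbb.
have B0 p q : 0 <= B p q by apply: avg_ge0 => // t; exact: ler0n.
have xy : x != y by apply: contraTneq odd_xyz => ->; rewrite odd_irr.
have xz : x != z.
  apply: contraTneq odd_xyz => ->; rewrite /odd_triple A_irr addbF (A_sym y z).
  by rewrite addbb.
have yz : y != z.
  by apply: contraTneq odd_xyz => ->; rewrite /odd_triple A_irr addbF addbb.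
(* The three pairs are distinct, so their values are separate terms of the double sum. *)
have sumB : B x y + B x z + B y z <= \S_p \S_q B p q.
  rewrite avgE mul1r (bigD1 x) //= (bigD1 y) 1?eq_sym //=.
  have rest : 0 <= \sum_(i | (i != x) && (i != y)) \S_q B i q.
    by apply: sumr_ge0 => i _; apply: avg_ge0.
  have row p q : B p q <= \S_q B p q.
    by rewrite avgE mul1r (bigD1 q) //= lerDl sumr_ge0.
  have : B x y + B x z <= \S_q B x q.
    rewrite avgE mul1r (bigD1 y) //= (bigD1 z) 1?eq_sym //= addrA lerDl.
    by rewrite sumr_ge0.
  have := row y z; lra.
apply: le_trans nB (le_trans sumB _).
(* An odd triple spans one edge or three, so it has an edge whose ends are both adjacent or both
   non-adjacent to the third vertex. The three possible places of this edge give the factor 3. *)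
pose h p q t : R := a p q * (b p t * b q t + a p t * a q t).
have hE : edge_sum (fun x y => e x y + c x y) = \S_p \S_q \S_t h p q t.
  apply: eq_avg => p; apply: eq_avg => q; rewrite -avgD -avgZ.
  exact: eq_avg.
apply: (le_trans (y := \S_p \S_q \S_t (h p q t + h p t q + h q t p))).
  apply: le_avg => // p; apply: le_avg => // q; apply: le_avg => // t.
  rewrite /h /odd_triple !nadjrE /adjr (A_sym q p) (A_sym t p) (A_sym t q).
  by case: (A p q); case: (A p t); case: (A q t); rewrite /=; lra.
rewrite hE; have -> : \S_p \S_q \S_t (h p q t + h p t q + h q t p) =
    (\S_p \S_q \S_t h p q t) + (\S_p \S_q \S_t h p t q) + (\S_p \S_q \S_t h q t p).
  rewrite -!avgD; apply: eq_avg => p; rewrite -!avgD; apply: eq_avg => q.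
  by rewrite -!avgD.
have -> : \S_p \S_q \S_t h p t q = \S_p \S_q \S_t h p q t.
  by apply: eq_avg => p; rewrite exchange_avg.
have -> : \S_p \S_q \S_t h q t p = \S_p \S_q \S_t h p q t.
  by rewrite exchange_avg; apply: eq_avg => p; rewrite exchange_avg.
lra.
Qed.

Hypothesis n_large : 1000%:R <= n.
Let dl := n / 200%:R.

(** Every common neighbour or common non-neighbour of an edge adds at least [n / 5] to its deficit.
    An odd triple thus makes the total deficit at least [n ^ 2 / 15], half of which is lost, while
    the main term is at most [C ^ 2 / 8] with [C = n ^ 2 - 3 n + 4]. *)
Lemma regular_bound x y z : irreflexive A ->
  (forall v, `|d v - n / 2%:R| <= dl) -> odd_triple x y z ->
  exact_count <= (n ^+ 2 - 3%:R * n + 4%:R) ^+ 2 / 8%:R - n ^+ 2 / 30%:R.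
Proof.
move=> A_irr reg odd_xyz; have := odd_triple_edges A_irr odd_xyz.
have : (n / 5%:R) * edge_sum (fun x y => e x y + c x y) <= edge_sum exact_deficit.
  rewrite -edge_avgZ; apply: le_edge_avg => // p q.
  have := reg p; have := reg q; rewrite !ler_norml => /andP[q1 q2] /andP[p1 p2].
  have eE := mfarE (1 : R) A p q; have c0 := mcodeg_ge0 A le01 p q.
  have e0 := mfar_ge0 A le01 p q; have cl := mcodeg_lel A le01 p q.
  have F : e p q * (n / 2%:R - dl) <= far_degree 1 A p q.
    rewrite /mfar /far_degree -avgZr; apply: le_avg => // t.
    rewrite ler_wpM2l ?mulr_ge0 ?nadjr_ge0 //.
    by have := reg t; rewrite ler_norml => /andP[]; lra.
  rewrite /exact_deficit /edge_deficit; move: F eE c0 e0 cl q1 q2 p1 p2.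
  rewrite /dl; move: (far_degree _ _ _ _) (e p q) (c p q) (d p) (d q) n n_large.
  move=> F E C dp dq k k1000 HF HE C0 E0 Cp q1 q2 p1 p2.
  have : 0 <= E * (k / 2%:R - k / 200%:R - k / 5%:R - E + C * (3%:R / 2%:R)).
    by rewrite mulr_ge0 //; lra.
  have : 0 <= C * (k / 2%:R - C / 2%:R - 3%:R - k / 5%:R) by rewrite mulr_ge0 //; lra.
  rewrite !expr2; lra.
rewrite exact_countE; set S := edge_sum (fun x y => _); set L := edge_sum _.
move: n n_large M => k k1000 m LS kS.
have : k * k <= k * (3%:R * S) by rewrite ler_wpM2l //; lra.
have := sqr_ge0 (k ^+ 2 - 3%:R * k + 4%:R - 2%:R * m).
rewrite [X in 0 <= X](_ : _ = (k ^+ 2 - 3%:R * k + 4%:R) ^+ 2 -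
  4%:R * (m * (k ^+ 2 - 3%:R * k + 4%:R - m))); last by ring.
rewrite (expr2 k); lra.
Qed.

End ExactCount.

(** * Lower bounds for the deficit of a single edge *)

Section DeficitArithmetic.

Variables (R : realFieldType) (k F E C dx dy E0 E1 G F1 s : R).
Hypotheses (k1000 : 1000%:R <= k).
Hypotheses (HF : E0 * (k / 2%:R - k / 200%:R) + F1 <= F) (F10 : 0 <= F1).
Hypotheses (HE : E = k - dx - dy + C) (HS : E = E0 + E1).
Hypotheses (C0 : 0 <= C) (Cx : C <= dx) (Cy : C <= dy) (dxk : dx <= k).
Hypotheses (E00 : 0 <= E0) (E10 : 0 <= E1) (E1s : E1 <= s) (sk : s <= k / 200%:R).

Local Notation D := (F - E ^+ 2 + C * (k - C) / 2%:R + 3%:R * (E * C) / 2%:R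
  + 3%:R * E + (- 3%:R) * C).

(** [E0] and [E1] stand for the dense and the sparse common non-neighbours of the edge, [s] for the
    number of sparse vertices, and [G] for the adjacencies between sparse vertices and the two
    ends. *)
Lemma deficit_dense : 1 <= s -> s - E1 <= G ->
  k / 2%:R - k / 200%:R <= dx -> dx <= k / 2%:R + k / 200%:R ->
  k / 2%:R - k / 200%:R <= dy ->
  F1 + k / 5%:R * (E0 + C) - s * (s - 3%:R) - 2%:R * G <= D.
Proof.
move: k1000 HF F10 HE HS C0 Cx Cy dxk E00 E10 E1s sk.
move=> hk hF f10 hE hS c0 cx cy xk e00 e10 e1s hs.
move=> s1 HG x1 x2 y1.
have p1 : 0 <= E0 * (k / 2%:R - k / 200%:R - k / 5%:R - E0 - 2%:R * E1
    + C * (3%:R / 2%:R)) by rewrite mulr_ge0 //; lra.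
have p2 : 0 <= C * (k / 2%:R - C / 2%:R - 3%:R - k / 5%:R) by rewrite mulr_ge0 //; lra.
(* The sparse part [3 E1 - E1 ^ 2] exceeds [- s (s - 3) - 2 (s - E1)] by exactly this product. *)
have p3 : 0 <= (s - E1) * (s + E1 - 1) by rewrite mulr_ge0; lra.
have p4 : 0 <= E1 * C by rewrite mulr_ge0.
move: hF; rewrite hS !expr2; lra.
Qed.

(** With two sparse ends [E] may be close to [k], where [E * (k / 2) - E ^ 2] drops to
    [- k ^ 2 / 2]. *)
Lemma deficit_sparse_pair : dx <= k / 200%:R ->
  - (k ^+ 2 / 2%:R) - 6%:R * (k * (k / 200%:R)) <= D.
Proof.
move: k1000 HF F10 HE HS C0 Cx Cy dxk E00 E10 E1s sk.
move=> hk hF f10 hE hS c0 cx cy xk e00 e10 e1s hs.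
move=> x1.
have k2 : 1000%:R * k <= k * k by rewrite ler_wpM2r //; lra.
have Ck0 : 0 <= C * (k - C) by rewrite mulr_ge0 //; lra.
have EC0 : 0 <= E * C by rewrite mulr_ge0 //; lra.
have E1k : E1 * (k / 2%:R - k / 200%:R) <= k / 200%:R * (k / 2%:R - k / 200%:R).
  by rewrite ler_wpM2r //; lra.
have p1 : 0 <= E * (k - E) by rewrite mulr_ge0 //; lra.
have p2 : 0 <= (k - E) * (k / 2%:R + k / 200%:R) by rewrite mulr_ge0 //; lra.
have hE0 : E0 = E - E1 by lra.
move: hF; rewrite hE0 !expr2; lra.
Qed.

(** As [dy] is near [k / 2], so [E] is at most about [k / 2], and [E * (k / 2)] nearly offsets
    [E ^ 2]. *)
Lemma deficit_sparse_one : dx <= k / 200%:R -> k / 2%:R - k / 200%:R <= dy ->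
  - (3%:R * (k * (k / 200%:R))) <= D.
Proof.
move: k1000 HF F10 HE HS C0 Cx Cy dxk E00 E10 E1s sk.
move=> hk hF f10 hE hS c0 cx cy xk e00 e10 e1s hs.
move=> x1 y1.
have k2 : 1000%:R * k <= k * k by rewrite ler_wpM2r //; lra.
have Ck0 : 0 <= C * (k - C) by rewrite mulr_ge0 //; lra.
have EC0 : 0 <= E * C by rewrite mulr_ge0 //; lra.
have E1k : E1 * (k / 2%:R - k / 200%:R) <= k / 200%:R * (k / 2%:R - k / 200%:R).
  by rewrite ler_wpM2r //; lra.
have p1 : 0 <= E * (k / 2%:R + k / 200%:R - E) by rewrite mulr_ge0 //; lra.
have p2 : 0 <= (k - E) * (k / 100%:R) by rewrite mulr_ge0 //; lra.
have hE0 : E0 = E - E1 by lra.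
move: hF; rewrite hE0 !expr2; lra.
Qed.

End DeficitArithmetic.

(** * Numerical inequalities for the loss caused by sparse vertices *)

Section SparseGap.

Variable R : realFieldType.
Implicit Types k m s S : R.

(** In this range [- s (s - 3)] is at least 2, and [2 m], which is nearly [k ^ 2], already covers
    the left side. *)
Lemma sparse_gap_few k m s S : 1000%:R <= k -> 0 <= S -> 1 <= s <= 2%:R ->
  k ^+ 2 / 2%:R - 3%:R / 2%:R * (k * (k / 200%:R)) <= m ->
  k ^+ 2 / 2%:R + 326%:R / 4000%:R * (k ^+ 2 * s ^+ 2) <=
  (k ^+ 2 - 3%:R * k + 4%:R - 2%:R * m) ^+ 2 / 4%:R - s * (s - 3%:R) * m + k / 5%:R * S.
Proof.
move=> k1000 S0 /andP[s1 s2] m_low.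
have k0 : 0 <= k by lra.
have kk0 : 0 <= k ^+ 2 by exact: sqr_ge0.
have m0 : 0 <= m by move: m_low kk0; clear; rewrite (expr2 k); lra.
have h1 : 0 <= (k ^+ 2 - 3%:R * k + 4%:R - 2%:R * m) ^+ 2 / 4%:R.
  by rewrite mulr_ge0 ?sqr_ge0 // invr_ge0.
have h2 : 0 <= (2%:R - s) * (s - 1) * m by rewrite !mulr_ge0 // subr_ge0.
have h3 : k ^+ 2 * s ^+ 2 <= k ^+ 2 * 4%:R.
  by rewrite ler_wpM2l //; move: s1 s2; clear; rewrite expr2; nra.
have h4 : 0 <= k / 5%:R * S by rewrite !mulr_ge0 // invr_ge0.
move: kk0 m_low h1 h2 h3 h4; clear.
move: (_ ^+ 2 / 4%:R) (k / 5%:R * S) (k ^+ 2 * s ^+ 2) => q r t.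
rewrite (expr2 k); lra.
Qed.

(* [k - s] is the number of dense vertices; [D] measures the excess of
   their edges over the number in a balanced complete bipartite graph. *)
Lemma sparse_gap_many k m s S : 1000%:R <= k -> 0 <= S -> 3%:R <= s <= k / 200%:R ->
  k ^+ 2 / 2%:R - 3%:R / 2%:R * (k * (k / 200%:R)) <= m ->
  m * (2%:R * m - (k - s) ^+ 2) <= (k - s) * S ->
  k ^+ 2 / 2%:R + 326%:R / 4000%:R * (k ^+ 2 * s ^+ 2) <=
  (k ^+ 2 - 3%:R * k + 4%:R - 2%:R * m) ^+ 2 / 4%:R - s * (s - 3%:R) * m + k / 5%:R * S.
Proof.
move=> k1000 S0 /andP[s3 sk] m_low mantel.
have k0 : 0 <= k by lra.
have s0 : 0 <= s by lra.
have hs3 : 0 <= s - 3%:R by lra.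
have hks : 0 <= k / 200%:R - s by lra.
have hk_s : 0 <= k - s by lra.
have hk_sk : k - s <= k by lra.
have hA : 0 <= 1995%:R / 1000%:R * s - 3%:R by lra.
have kk0 : 0 <= k ^+ 2 by exact: sqr_ge0.
have ss := mulr_ge0 s0 hs3.
have kS := mulr_ge0 k0 S0.
have gs := mulr_ge0 hks s0.
have gk := mulr_ge0 hks k0.
(* [A0] is the value of [k ^ 2 - 3 k + 4 - 2 m] at [2 m = (k - s) ^ 2], that is, for [D = 0]. *)
pose A0 := (2%:R * s - 3%:R) * k + 4%:R - s ^+ 2.
pose D := 2%:R * m - (k - s) ^+ 2.
have A0_low : (1995%:R / 1000%:R * s - 3%:R) * k <= A0.
  by rewrite /A0; move: gs; clear; rewrite expr2; lra.
have A0_up : A0 <= k ^+ 2 / 100%:R.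
  have := sqr_ge0 s; rewrite /A0; move: gk k1000; clear; rewrite (expr2 k); lra.
have A00 : 0 <= A0 by apply: le_trans A0_low; rewrite mulr_ge0.
have A0_sqr : (1995%:R / 1000%:R * s - 3%:R) ^+ 2 * k ^+ 2 <= A0 ^+ 2.
  by rewrite -exprMn ler_sqr ?nnegrE // mulr_ge0.
(* The case [D = 0]: [A0 ^ 2 / 4] is about [(s - 3/2) ^ 2 k ^ 2] and exceeds the loss
   [s (s - 3) k ^ 2 / 2] by enough. *)
have base : k ^+ 2 * (2%:R^-1 + 326%:R / 4000%:R * s ^+ 2 + s * (s - 3%:R) / 2%:R) <=
    (1995%:R / 1000%:R * s - 3%:R) ^+ 2 * k ^+ 2 / 4%:R.
  have := mulr_ge0 kk0 (mulr_ge0 hs3 hs3); have := mulr_ge0 kk0 hs3.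
  move: kk0; clear; move: (k ^+ 2) => K; rewrite !expr2; lra.
have ksk : (k - s) ^+ 2 <= k ^+ 2 by rewrite ler_sqr ?nnegrE.
have sm := ler_wpM2l ss ksk.
have -> : k ^+ 2 - 3%:R * k + 4%:R - 2%:R * m = A0 - D by rewrite /A0 /D; clear; ring.
have mE : m = ((k - s) ^+ 2 + D) / 2%:R by rewrite /D; clear; field.
have DE : (A0 - D) ^+ 2 = A0 ^+ 2 - 2%:R * (A0 * D) + D ^+ 2 by clear; ring.
have smE : s * (s - 3%:R) * m = s * (s - 3%:R) * (k - s) ^+ 2 / 2%:R
    + s * (s - 3%:R) * D / 2%:R by rewrite {1}mE; clear; field.
(* A positive [D] is paid for by [S] through [mantel]; for [D <= 0] the terms linear in [D] are
   nonpositive. *)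
have AD_bound : A0 * D / 2%:R + s * (s - 3%:R) * D / 2%:R <= k * S / 5%:R.
  rewrite -/D in mantel; case: (lerP D 0) => [D0|/ltW D0].
    have := mulr_ge0_le0 A00 D0; have := mulr_ge0_le0 ss D0.
    move: kS; clear; move: (A0 * D) (s * (s - 3%:R) * D) (k * S) => x y z; lra.
  have mS : m * D <= k * S by apply: le_trans mantel _; rewrite ler_wpM2r.
  have AD := ler_wpM2r D0 A0_up.
  have s_up : s * (s - 3%:R) <= k ^+ 2 / 200%:R.
    by move: gs gk s0 kk0; clear; rewrite (expr2 k); lra.
  have sD := ler_wpM2r D0 s_up.
  have mD : (k ^+ 2 / 2%:R - 3%:R / 2%:R * (k * (k / 200%:R))) * D <= m * D.
    by rewrite ler_wpM2r.
  have kD := mulr_ge0 kk0 D0.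
  move: mS AD sD mD kD; clear; move: (m * D) (k * S) (A0 * D) (s * (s - 3%:R) * D).
  by move=> x y z t; rewrite (expr2 k); lra.
have D2 := sqr_ge0 D.
rewrite smE DE; move: base A0_sqr sm AD_bound D2; clear.
move: (A0 * D) (s * (s - 3%:R) * D) (A0 ^+ 2) (D ^+ 2) ((k - s) ^+ 2)
  ((1995%:R / 1000%:R * s - 3%:R) ^+ 2 * k ^+ 2) (s ^+ 2) => x y z t u v w.
move: (k ^+ 2) => K; lra.
Qed.

(** [q] stands for the degree sum of the sparse vertices and [p] for the adjacent ordered pairs of
    them. A unit of [p] costs [k ^ 2 / 2], a unit of [q >= p] gains slightly less; the shortfall is
    at most [326/4000 k ^ 2 p], and [p <= s ^ 2] lets the gap cover it. *)
Lemma sparse_count_arith k m s S L Fs G p q M : 1000%:R <= k ->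
  k ^+ 2 / 2%:R - 3%:R / 2%:R * (k * (k / 200%:R)) <= m ->
  Fs + k / 5%:R * S + (- (s * (s - 3%:R))) * m + (- 2%:R) * G + (- (k ^+ 2 / 2%:R)) * p
    + (- (3%:R * (k * (k / 200%:R)))) * q + (- (3%:R * (k * (k / 200%:R)))) * q <= L ->
  k ^+ 2 / 2%:R + 326%:R / 4000%:R * (k ^+ 2 * s ^+ 2) <=
    (k ^+ 2 - 3%:R * k + 4%:R - 2%:R * m) ^+ 2 / 4%:R - s * (s - 3%:R) * m + k / 5%:R * S ->
  m = M - 2%:R * q + p -> q * (m - 2%:R * k * (k / 200%:R)) <= Fs ->
  G <= 2%:R * k * q -> p <= q -> p <= s ^+ 2 -> 0 <= p ->
  (M * (k ^+ 2 - 3%:R * k + 4%:R - M) - L) / 2%:R <=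
  (k ^+ 2 - 3%:R * k + 4%:R) ^+ 2 / 8%:R - k ^+ 2 / 4%:R.
Proof.
move=> k1000 f5 HL gap f1 f2 f3 pq ps p0.
have k0 : 0 <= k by clear -k1000; lra.
have q0 : 0 <= q by clear -p0 pq; lra.
have ME : M = m + (2%:R * q - p) by rewrite f1; clear; ring.
have kk0 : 0 <= k ^+ 2 by exact: sqr_ge0.
have kk : 1000%:R * k <= k ^+ 2 by rewrite expr2 ler_wpM2r.
have qm : q * (k ^+ 2 * (1%:R / 2%:R - 7%:R / 400%:R)) <= q * (m - 2%:R * k * (k / 200%:R)).
  by rewrite ler_wpM2l //; move: f5; clear; rewrite expr2; lra.
have kq : 1000%:R * (k * q) <= k ^+ 2 * q by rewrite mulrA ler_wpM2r.
have P0 : 0 <= 2%:R * q - p by clear -q0 pq; lra.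
pose C := k ^+ 2 - 3%:R * k + 4%:R.
have Cm : (2%:R * q - p) * (C - 2%:R * m - (2%:R * q - p)) <=
    (2%:R * q - p) * (k ^+ 2 * (3%:R / 200%:R)).
  rewrite ler_wpM2l //; move: f5 P0 k1000; rewrite /C; clear; rewrite !expr2; lra.
have kkp := mulr_ge0 kk0 p0; have kkq := ler_wpM2l kk0 pq.
have kks := ler_wpM2l kk0 ps.
have PE : M * (C - M) = C ^+ 2 / 4%:R - (C - 2%:R * m) ^+ 2 / 4%:R
    + (2%:R * q - p) * (C - 2%:R * m - (2%:R * q - p)) by rewrite ME; clear; field.
rewrite -/C in gap; rewrite -/C PE.
have k200 : k * (k / 200%:R) = k ^+ 2 / 200%:R by clear; ring.
rewrite k200 in HL.
move: HL gap f2 qm f3 kq Cm kkp kkq kks; clear.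
move: ((2%:R * q - p) * (C - _ - _)) => x.
move: ((C - 2%:R * m) ^+ 2) (C ^+ 2) (q * (m - 2%:R * k * (k / 200%:R))) => y z t.
rewrite [2%:R * k * q]mulrC mulrCA [q * (2%:R * k)]mulrCA; lra.
Qed.

End SparseGap.

(** * Graphs with a few sparse vertices *)

Section SparseVertices.

Variables (R : realFieldType) (V : finType) (A : rel V).
Hypotheses (A_sym : symmetric A).

Local Notation "'\S_' x F" := (avg 1 (fun x : V => F))
  (at level 41, x name, F at level 41).
Local Notation n := (avg 1 (fun _ : V => 1 : R)).
Local Notation a := (adjr R A).
Local Notation b := (nadjr R A).
Local Notation d := (mdeg (1 : R) A).
Local Notation c := (mcodeg (1 : R) A).
Local Notation e := (mfar (1 : R) A).
Local Notation M := (\S_x d x).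
Local Notation edge_sum := (edge_avg (1 : R) A).
Local Notation deficit := (exact_deficit R A).

Let le01 : 0 <= 1 :> R := ler01.

Hypothesis n_large : 1000%:R <= n.
Let dl := n / 200%:R.

Definition sparse x : R := (d x <= dl)%R%:R.
Local Notation J := sparse.
Local Notation K x := (1 - sparse x).
Local Notation j := (\S_x J x).

Hypothesis J_or_half : forall x, d x <= dl \/ `|d x - n / 2%:R| <= dl.
Hypotheses (j_ge1 : 1 <= j) (j_le : j <= dl).

Lemma sparseP x : J x = 1 /\ d x <= dl \/
  [/\ J x = 0, n / 2%:R - dl <= d x & d x <= n / 2%:R + dl].
Proof.
rewrite /sparse; case: (lerP (d x) dl) => [|lt]; [by left | right].
case: (J_or_half x) => [|]; first by rewrite leNgt lt.
by rewrite ler_norml => /andP[? ?]; split => //; lra.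
Qed.

Lemma sparse01 x : 0 <= J x <= 1.
Proof. by rewrite /sparse ler0n lern1 leq_b1. Qed.

Definition far_dense x y := \S_z b x z * b y z * K z.
Definition far_sparse x y := \S_z b x z * b y z * J z.
Definition far_sparse_degree x y := \S_z b x z * b y z * (J z * d z).
Definition near_sparse x y := \S_z J z * (a x z + a y z).

Lemma mfar_split x y : e x y = far_dense x y + far_sparse x y.
Proof. by rewrite -avgD; apply: eq_avg => z; ring. Qed.

Lemma bb_ge0 x y z : 0 <= b x z * b y z.
Proof. by rewrite mulr_ge0 ?nadjr_ge0. Qed.

Lemma far_dense_ge0 x y : 0 <= far_dense x y.
Proof.
apply: avg_ge0 => // z; rewrite mulr_ge0 ?bb_ge0 //.
by have /andP[] := sparse01 z; lra.
Qed.

Lemma far_sparse_ge0 x y : 0 <= far_sparse x y.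
Proof.
by apply: avg_ge0 => // z; rewrite mulr_ge0 ?bb_ge0 //; have /andP[] := sparse01 z.
Qed.

Lemma far_sparse_degree_ge0 x y : 0 <= far_sparse_degree x y.
Proof.
by apply: avg_ge0 => // z; rewrite mulr_ge0 ?bb_ge0 // mulr_ge0 ?mdeg_ge0.
Qed.

Lemma far_sparse_le x y : far_sparse x y <= j.
Proof.
apply: le_avg => // z; have /andP[j0 j1] := sparse01 z.
by rewrite ler_piMl // -natrM lern1 mulnb leq_b1.
Qed.

Lemma near_sparse_ge x y : j - far_sparse x y <= near_sparse x y.
Proof.
rewrite -avgB; apply: le_avg => // z; have /andP[j0 j1] := sparse01 z.
have : 0 <= J z * (a x z * a y z) by rewrite !mulr_ge0 ?adjr_ge0.
rewrite !nadjrE; lra.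
Qed.

Lemma far_degree_split x y :
  far_dense x y * (n / 2%:R - dl) + far_sparse_degree x y <= far_degree 1 A x y.
Proof.
rewrite -[X in X + _]avgZr -avgD; apply: le_avg => // z; have B := bb_ge0 x y z.
case: (sparseP z) => [[-> _]|[-> lo _]]; first by rewrite subrr mul1r mulr0 mul0r add0r.
by rewrite subr0 mulr1 mul0r mulr0 addr0 ler_wpM2l.
Qed.

Lemma deficit_lower x y :
  K x * K y * (far_sparse_degree x y + n / 5%:R * (far_dense x y + c x y)
    - j * (j - 3%:R) - 2%:R * near_sparse x y)
  - J x * J y * (n ^+ 2 / 2%:R) - 3%:R * (n * dl) * (J x + J y) <= deficit x y.
Proof.
have F := far_degree_split x y; have Fs := far_sparse_degree_ge0 x y.
have eE := mfarE (1 : R) A x y; have eS := mfar_split x y.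
have c0 := mcodeg_ge0 A le01 x y; have cx := mcodeg_lel A le01 x y.
have cy := mcodeg_lel A le01 y x; rewrite mcodegC in cy.
have dn := mdeg_le A le01 x; have dn' := mdeg_le A le01 y.
have e0 := far_dense_ge0 x y; have s0 := far_sparse_ge0 x y.
have sj := far_sparse_le x y; have ns := near_sparse_ge x y.
have eE' : e x y = n - d y - d x + c x y by rewrite eE; ring.
have dense := deficit_dense n_large F Fs eE eS c0 cx cy dn e0 s0 sj j_le j_ge1 ns.
have pair := deficit_sparse_pair n_large F Fs eE eS c0 cx cy dn e0 s0 sj j_le.
have one := deficit_sparse_one n_large F Fs eE eS c0 cx cy dn e0 s0 sj j_le.
have one' := deficit_sparse_one n_large F Fs eE' eS c0 cy cx dn' e0 s0 sj j_le.
rewrite /exact_deficit /edge_deficit.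
case: (sparseP x) => [[-> x1]|[-> x1 x2]]; case: (sparseP y) => [[-> y1]|[-> y1 y2]].
- by have := pair x1; rewrite /dl; lra.
- by have := one x1 y1; rewrite /dl; lra.
- by have := one' y1 x1; rewrite /dl; lra.
- by have := dense x1 x2 y1; lra.
Qed.

Local Notation MJ := (\S_x J x * d x).
Local Notation JJ := (edge_sum (fun x y => J x * J y)).
Local Notation dense_sum f := (edge_sum (fun x y => K x * K y * f x y)).
Local Notation m00 := (dense_sum (fun _ _ => 1)).

Lemma K01 x : 0 <= K x <= 1.
Proof. by have /andP[? ?] := sparse01 x; apply/andP; split; lra. Qed.

Lemma KK01 x y : 0 <= K x * K y <= 1.
Proof.
have /andP[x0 x1] := K01 x; have /andP[y0 y1] := K01 y.
by rewrite mulr_ge0 //= mulr_ile1.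
Qed.

Lemma JdE x : J x * d x <= J x * dl.
Proof. by case: (sparseP x) => [[-> h]|[-> _ _]]; rewrite ?mul1r ?mul0r. Qed.

Lemma MJ_le : MJ <= j * dl.
Proof. by rewrite -avgZr; apply: le_avg => // x; exact: JdE. Qed.

Lemma edge_sumJl : edge_sum (fun x _ => J x) = MJ.
Proof. by rewrite edge_avg_l; apply: eq_avg => x; rewrite mulrC. Qed.

Lemma edge_sumJr : edge_sum (fun _ y => J y) = MJ.
Proof. by rewrite edge_avg_r //; apply: eq_avg => x; rewrite mulrC. Qed.

Lemma edge_sum1 : edge_sum (fun _ _ => 1) = M.
Proof. by rewrite (edge_avg_l 1 A (fun=> 1)); apply: eq_avg => x; rewrite mulr1. Qed.

Lemma JJ_ge0 : 0 <= JJ.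
Proof.
apply: edge_avg_ge0 => // x y; have /andP[? _] := sparse01 x.
by have /andP[? _] := sparse01 y; rewrite mulr_ge0.
Qed.

Lemma JJ_le_MJ : JJ <= MJ.
Proof.
rewrite -edge_sumJl; apply: le_edge_avg => // x y.
by have /andP[? ?] := sparse01 y; rewrite ler_piMr //; have /andP[] := sparse01 x.
Qed.

Lemma JJ_le_sqr : JJ <= j ^+ 2.
Proof.
rewrite expr2 -avgZr; apply: le_avg => // x; rewrite -avgZ; apply: le_avg => // y.
have /andP[? _] := sparse01 x; have /andP[? _] := sparse01 y.
by rewrite ler_piMl ?adjr_le1 ?mulr_ge0.
Qed.

Lemma m00E : m00 = M - 2%:R * MJ + JJ.
Proof.
have -> : m00 = edge_sum (fun x y => 1 + (-1) * J x + (-1) * J y + J x * J y).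
  by apply: eq_edge_avg => x y; ring.
by rewrite !edge_avgD !edge_avgZ edge_sumJl edge_sumJr edge_sum1; ring.
Qed.

Lemma m00_lower : n ^+ 2 / 2%:R - 3%:R / 2%:R * (n * dl) <= m00.
Proof.
have : (n - j) * (n / 2%:R - dl) <= M - MJ.
  rewrite -[X in X * _]avgB -avgZr -avgB; apply: le_avg => // x.
  case: (sparseP x) => [[-> h]|[-> h _]]; first by rewrite subrr mul0r mul1r subrr.
  by rewrite mul0r !subr0 mul1r.
have mj := MJ_le; have jj := JJ_ge0; have jl := j_le.
have : 0 <= (dl - j) * n by rewrite mulr_ge0; [| lra | have := n_large; lra].
rewrite m00E expr2; lra.
Qed.

Lemma edge_sum_adj z : edge_sum (fun x _ => a x z) <= n * d z.
Proof.
rewrite edge_avg_l -avgZ; apply: le_avg => // x.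
by rewrite (adjr_sym R A_sym x z) ler_wpM2r ?adjr_ge0 ?mdeg_le.
Qed.

Lemma edge_sum_adj' z : edge_sum (fun _ y => a y z) <= n * d z.
Proof. by rewrite -edge_avgC //; exact: edge_sum_adj. Qed.

Lemma exchange_edge_sum (g : V -> V -> V -> R) :
  edge_sum (fun x y => \S_z g x y z) = \S_z edge_sum (fun x y => g x y z).
Proof.
rewrite [RHS]exchange_avg; apply: eq_avg => x.
by rewrite [RHS]exchange_avg; apply: eq_avg => y; rewrite avgZ.
Qed.

Lemma dense_sum_near_sparse : dense_sum near_sparse <= 2%:R * n * MJ.
Proof.
apply: (le_trans (y := edge_sum near_sparse)).
  apply: le_edge_avg => // x y; have /andP[_ k1] := KK01 x y.
  rewrite ler_piMl //; apply: avg_ge0 => // z.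
  by rewrite mulr_ge0 ?addr_ge0 ?adjr_ge0 //; have /andP[] := sparse01 z.
rewrite exchange_edge_sum -avgZ; apply: le_avg => // z.
rewrite edge_avgZ edge_avgD; have /andP[j0 _] := sparse01 z.
have := ler_wpM2l j0 (edge_sum_adj z); have := ler_wpM2l j0 (edge_sum_adj' z); lra.
Qed.

(** A sparse vertex has at most [dl] neighbours, so it is a common non-neighbour of all but
    [2 n * dl] of the dense adjacent pairs. *)
Lemma dense_sum_far_sparse_degree :
  MJ * (m00 - 2%:R * n * dl) <= dense_sum far_sparse_degree.
Proof.
have -> : dense_sum far_sparse_degree =
    \S_z J z * d z * dense_sum (fun x y => b x z * b y z).
  rewrite [LHS](_ : _ = edge_sum (fun x y => \S_z K x * K y *
    (b x z * b y z * (J z * d z)))); last by apply: eq_edge_avg => x y; rewrite -avgZ.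
  rewrite exchange_edge_sum; apply: eq_avg => z; rewrite -edge_avgZ.
  by apply: eq_edge_avg => x y; ring.
rewrite -avgZr; apply: le_avg => // z.
case: (sparseP z) => [[-> h]|[-> _ _]]; last by rewrite !mul0r.
rewrite mul1r ler_wpM2l ?mdeg_ge0 //.
apply: (le_trans (y := edge_sum (fun x y => K x * K y * 1 + (-1) * a x z + (-1) * a y z))).
  rewrite !edge_avgD !edge_avgZ; have := edge_sum_adj z; have := edge_sum_adj' z.
  have : n * d z <= n * dl by rewrite ler_wpM2l //; have := n_large; lra.
  lra.
apply: le_edge_avg => // x y; have /andP[k0 k1] := KK01 x y; rewrite !nadjrE.
have ax := adjr_ge0 R A x z; have ay := adjr_ge0 R A y z.
have := ler_piMl ax k1; have := ler_piMl ay k1.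
have : 0 <= K x * K y * (a x z * a y z) by rewrite mulr_ge0 // mulr_ge0.
lra.
Qed.

Definition dense_deg x := \S_z a x z * K z.

Lemma m00_dense_deg : m00 = \S_x K x * dense_deg x.
Proof.
by apply: eq_avg => x; rewrite /dense_deg -avgZ; apply: eq_avg => y; ring.
Qed.

Lemma dense_sum_deg : dense_sum (fun x _ => dense_deg x) = \S_x K x * dense_deg x ^+ 2.
Proof.
apply: eq_avg => x; rewrite expr2 mulrA [in X in _ = _ * X]/dense_deg -avgZ.
by apply: eq_avg => y; ring.
Qed.

(* Mantel's bound for the graph spanned by the dense vertices, with an error
   term that counts the deviations from a complete bipartite graph. *)
Lemma dense_mantel : m00 * (2%:R * m00 - (n - j) ^+ 2) <=
  (n - j) * dense_sum (fun x y => far_dense x y + c x y).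
Proof.
have nj : 0 < n - j by have := n_large; have := j_le; rewrite /dl; lra.
(* Counting dense vertices only, [dense_deg x + dense_deg y] exceeds [n - j] by the common
   neighbours minus the common non-neighbours. *)
have low : 2%:R * (\S_x K x * dense_deg x ^+ 2) - (n - j) * m00 <=
    dense_sum (fun x y => far_dense x y + c x y).
  apply: (le_trans (y := edge_sum (fun x y => K x * K y * dense_deg x
      + K y * K x * dense_deg y + (- (n - j)) * (K x * K y * 1)))).
    rewrite !edge_avgD edge_avgZ (edge_avgC 1 A_sym (fun x y => K x * K y * dense_deg x)).
    by rewrite dense_sum_deg; lra.
  apply: le_edge_avg => // x y; have /andP[k0 _] := KK01 x y.
  rewrite [K y * K x]mulrC [X in _ + X]mulrCA -!mulrDr ler_wpM2l //.
  rewrite mulr1 opprB -[j - n]avgB -!avgD; apply: le_avg => // z; rewrite !nadjrE.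
  by rewrite /adjr; case: (A x z); case: (A y z); case: (sparseP z) => [[-> _]|[-> _ _]];
    rewrite /=; lra.
(* Cauchy-Schwarz, as nonnegativity of a weighted variance. *)
have cs : m00 ^+ 2 <= (n - j) * (\S_x K x * dense_deg x ^+ 2).
  have : 0 <= \S_x K x * ((n - j) * dense_deg x - m00) ^+ 2.
    by apply: avg_ge0 => // x; rewrite mulr_ge0 ?sqr_ge0 //; have /andP[] := K01 x.
  have -> : \S_x K x * ((n - j) * dense_deg x - m00) ^+ 2 =
      (n - j) * ((n - j) * (\S_x K x * dense_deg x ^+ 2) - m00 ^+ 2).
    have -> : \S_x K x * ((n - j) * dense_deg x - m00) ^+ 2 =
        (n - j) ^+ 2 * (\S_x K x * dense_deg x ^+ 2)
        - 2%:R * (n - j) * m00 * (\S_x K x * dense_deg x) + m00 ^+ 2 * (\S_x K x).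
      move: (n - j) m00 => p q; rewrite -!avgZ -avgB -avgD; apply: eq_avg => x; ring.
    by rewrite -m00_dense_deg [\S_x K x]avgB; ring.
  by rewrite pmulr_rge0 // subr_ge0.
have := ler_wpM2l (ltW nj) low; move: cs; rewrite !expr2; lra.
Qed.

(** The disjunction records that [j] is an integer; the two cases are settled by [sparse_gap_few]
    and [sparse_gap_many]. *)
Theorem sparse_bound : j <= 2%:R \/ 3%:R <= j ->
  exact_count R A <= (n ^+ 2 - 3%:R * n + 4%:R) ^+ 2 / 8%:R - n ^+ 2 / 4%:R.
Proof.
move=> j23; rewrite exact_countE //.
set L := edge_sum deficit; pose S := dense_sum (fun x y => far_dense x y + c x y).
have HL : dense_sum far_sparse_degree + n / 5%:R * S + (- (j * (j - 3%:R))) * m00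
    + (- 2%:R) * dense_sum near_sparse + (- (n ^+ 2 / 2%:R)) * JJ
    + (- (3%:R * (n * dl))) * MJ + (- (3%:R * (n * dl))) * MJ <= L.
  rewrite -{1}edge_sumJl -edge_sumJr -!edge_avgZ -!edge_avgD.
  apply: le_edge_avg => // x y; apply: le_trans (deficit_lower x y).
  by rewrite le_eqVlt; apply/orP; left; apply/eqP; clear; ring.
have S0 : 0 <= S.
  apply: edge_avg_ge0 => // x y; have /andP[k0 _] := KK01 x y.
  by rewrite mulr_ge0 // addr_ge0 ?far_dense_ge0 ?mcodeg_ge0.
have f5 := m00_lower; have mantel := dense_mantel.
have gap : n ^+ 2 / 2%:R + 326%:R / 4000%:R * (n ^+ 2 * j ^+ 2) <=
    (n ^+ 2 - 3%:R * n + 4%:R - 2%:R * m00) ^+ 2 / 4%:R - j * (j - 3%:R) * m00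
    + n / 5%:R * S.
  case: j23 => j23; first by apply: sparse_gap_few => //; rewrite j_ge1.
  by apply: sparse_gap_many => //; rewrite j23.
have f1 := m00E; have f2 := dense_sum_far_sparse_degree.
have f3 := dense_sum_near_sparse.
have f6 := JJ_le_MJ; have f6' := JJ_le_sqr; have f6'' := JJ_ge0; have n1000 := n_large.
exact: sparse_count_arith n1000 f5 HL gap f1 f2 f3 f6 f6' f6''.
Qed.

End SparseVertices.

(** * Graphs from symmetric irreflexive relations *)

Section RelationGraphs.

Variable V : finType.

Definition rel_edges (A : rel V) : {set {set V}} :=
  [set e | [exists x, [exists y, [&& e == [set x; y], x != y & A x y]]]].

Lemma rel_edges_family A : edge_family (rel_edges A).
Proof.
apply/forall_inP => e; rewrite inE => /existsP[x /existsP[y /and3P[/eqP-> xy _]]].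
by rewrite cards2 xy.
Qed.

Definition rel_graph A : graph V := Graph (rel_edges_family A).

Lemma adj_rel_graph (A : rel V) : symmetric A -> irreflexive A -> adj (rel_graph A) =2 A.
Proof.
move=> A_sym A_irr x y; rewrite /adj /= inE; apply/idP/idP; last first.
  move=> Axy; apply/existsP; exists x; apply/existsP; exists y; rewrite eqxx Axy.
  by rewrite andbT /=; apply: contraTneq Axy => ->; rewrite A_irr.
case/existsP=> u /existsP[v /and3P[/eqP xyuv uv Auv]].
have xI : x \in [set u; v] by rewrite -xyuv !inE eqxx.
have yI : y \in [set u; v] by rewrite -xyuv !inE eqxx orbT.
have xy : x != y.
  by have := cards2 x y; rewrite xyuv cards2 uv; case: (x != y).
move: xI yI xy; rewrite !inE => /orP[]/eqP-> /orP[]/eqP->; rewrite ?eqxx //.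
by rewrite A_sym.
Qed.

Lemma adj_sym (G : graph V) : symmetric (adj G).
Proof. by move=> x y; rewrite /adj setUC. Qed.

Lemma adj_irr (G : graph V) : irreflexive (adj G).
Proof.
move=> x; rewrite /adj; apply/negP => xx.
by have /forall_inP/(_ _ xx) := edgesP G; rewrite setUid cards1.
Qed.

End RelationGraphs.

(** * Embeddings of [H] as copatterns *)

Section EmbeddingCount.

(** For irreflexive [A] the adjacencies separate [t] from the others: [x] is adjacent to [t], but
    not to itself, [y] or [z]. *)
Definition copattern_inj (V : finType) (A : rel V) x y z t : bool :=
  [&& A x t, ~~ A x y, ~~ A x z, ~~ A y z & [&& x != y, x != z & y != z]].

Definition copattern_count (V : finType) (A : rel V) : nat :=
  (\sum_x \sum_y \sum_z \sum_t copattern_inj A x y z t)%N.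

Lemma eq_copattern_count (V : finType) (A B : rel V) :
  A =2 B -> copattern_count A = copattern_count B.
Proof.
move=> AB; rewrite /copattern_count; do 4!(apply: eq_bigr => ? _).
by rewrite /copattern_inj !AB.
Qed.

Lemma copattern_count_bij (V W : finType) (A : rel V) (g : W -> V) : bijective g ->
  copattern_count A = copattern_count (fun x y => A (g x) (g y)).
Proof.
move=> g_bij; have g_inj := bij_inj g_bij.
have gE (F : V -> nat) : (\sum_x F x = \sum_x F (g x))%N.
  by rewrite (reindex g) //; apply: onW_bij.
rewrite /copattern_count gE; apply: eq_bigr => x _; rewrite gE; apply: eq_bigr => y _.
rewrite gE; apply: eq_bigr => z _; rewrite gE; apply: eq_bigr => t _.
by rewrite /copattern_inj !(eqtype.inj_eq g_inj).
Qed.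

Variable V : finType.

Local Notation "''v_' k" := (@Ordinal 4 k isT) (at level 8, k at level 2).

Definition place (p : V * (V * (V * V))) : {ffun 'I_4 -> V} :=
  [ffun i : 'I_4 => match val i with
    | 0 => p.1 | 1 => p.2.1 | 2 => p.2.2.2 | _ => p.2.2.1 end].

Definition unplace (f : {ffun 'I_4 -> V}) : V * (V * (V * V)) :=
  (f 'v_0, (f 'v_1, (f 'v_3, f 'v_2))).

Lemma ord4P (P : 'I_4 -> Prop) : P 'v_0 -> P 'v_1 -> P 'v_2 -> P 'v_3 -> forall i, P i.
Proof.
move=> P0 P1 P2 P3 [[|[|[|[|//]]]] lti]; by rewrite (bool_irrelevance lti isT).
Qed.

Lemma place_bij : bijective place.
Proof.
exists unplace => [[x [y [z t]]]|f]; first by rewrite /unplace !ffunE.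
by apply/ffunP; elim/ord4P; rewrite ffunE.
Qed.

Lemma embedding_place (G : graph V) x y z t :
  embedding H G (place (x, (y, (z, t)))) = copattern_inj (adj G) x y z t.
Proof.
set f := place _; have f0 : f 'v_0 = x by rewrite ffunE.
have f1 : f 'v_1 = y by rewrite ffunE.
have f2 : f 'v_2 = t by rewrite ffunE.
have f3 : f 'v_3 = z by rewrite ffunE.
have im i j : f @: [set i; j] = [set f i; f j] by rewrite imsetU !imset_set1.
have -> : embedding H G f = [&& injectiveb f, adj G x t, ~~ adj G x y, ~~ adj G x z
    & ~~ adj G y z].
  rewrite /embedding; congr (_ && _).
  have -> : [forall e in red H, f @: e \in edges G] = adj G x t.
    apply/forall_inP/idP => [h|h e].
      by have := h _ (set11 _); rewrite im f0 f2.
    by rewrite inE => /eqP->; rewrite im f0 f2.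
  congr (_ && _); apply/forall_inP/idP => [h|/and3P[h01 h03 h13] e].
    have h01 := h [set 'v_0; 'v_1]; have h03 := h [set 'v_0; 'v_3].
    have h13 := h [set 'v_1; 'v_3]; move: h01 h03 h13.
    by rewrite !im f0 f1 f3 !inE !eqxx !orbT /adj => -> // -> // ->.
  by rewrite !inE => /orP[/orP[]|] /eqP->; rewrite im ?f0 ?f1 ?f3.
rewrite /copattern_inj; case Axt: (adj G x t); rewrite ?andbF //=.
case Axy: (adj G x y); rewrite ?andbF //=; case Axz: (adj G x z); rewrite ?andbF //=.
case Ayz: (adj G y z); rewrite ?andbF ?andbT //=.
have xt : x != t by apply: contraTneq Axt => <-; rewrite adj_irr.
have yt : y != t by apply: contraTneq Axt => <-; rewrite Axy.
have zt : z != t by apply: contraTneq Axt => <-; rewrite Axz.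
apply/injectiveP/and3P => [inj|[xy xz yz]].
  by split; rewrite -?f0 -?f1 -?f3 (eqtype.inj_eq inj).
move=> i j; elim/ord4P: i; elim/ord4P: j => //; rewrite ?f0 ?f1 ?f2 ?f3 => eq_f.
all: by move: xt yt zt xy xz yz; rewrite eq_f ?eqxx.
Qed.

Lemma Lambda_copattern (G : graph V) : Lambda H G = copattern_count (adj G).
Proof.
rewrite /Lambda cardsE -sum1_card (reindex place); last exact: onW_bij place_bij.
rewrite big_mkcond /= /copattern_count.
under [RHS]eq_bigr => x _ do under eq_bigr => y _ do rewrite pair_bigA /=.
under [RHS]eq_bigr => x _ do rewrite pair_bigA /=.
rewrite pair_bigA /=; apply: eq_bigr => [[x [y [z t]]] _].
rewrite -embedding_place unfold_in -[X in if X then _ else _]/(embedding H G _).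
by case: embedding.
Qed.

End EmbeddingCount.

(** The maximum ranges over graphs on ordinals, so the relation is transported along the enumeration
    of [V]. *)
Lemma copattern_count_le_max (V : finType) (A : rel V) : symmetric A -> irreflexive A ->
  (copattern_count A <= Lambda_max H #|V|)%N.
Proof.
move=> A_sym A_irr; rewrite (copattern_count_bij A (@enum_val_bij V)).
set B := fun x y => _; have B_sym : symmetric B by move=> x y; exact: A_sym.
have B_irr : irreflexive B by move=> x; exact: A_irr.
rewrite -(eq_copattern_count (adj_rel_graph B_sym B_irr)) -Lambda_copattern.
exact: leq_bigmax.
Qed.

(** * The embedding count as a sum in an ordered field *)

Section CountsAsSums.

Variables (R : realFieldType) (V : finType) (A : rel V).
Hypotheses (A_sym : symmetric A) (A_irr : irreflexive A).

Local Notation "'\S_' x F" := (avg 1 (fun x : V => F))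
  (at level 41, x name, F at level 41).
Local Notation n := (avg 1 (fun _ : V => 1 : R)).
Local Notation a := (adjr R A).
Local Notation b := (nadjr R A).
Local Notation d := (mdeg (1 : R) A).

Lemma avg1E (f : V -> R) : \S_x f x = \sum_x f x.
Proof. by rewrite avgE mul1r. Qed.

Lemma avg_scale (w : R) (f : V -> R) : avg w f = w * \S_x f x.
Proof. by rewrite !avgE mul1r. Qed.

Lemma card_avg : n = #|V|%:R.
Proof. by rewrite avg1E sumr_const. Qed.

Lemma sum_eq_indicator (x : V) (f : V -> R) : \S_y (x == y)%:R * f y = f x.
Proof.
rewrite avg1E (bigD1 x) //= eqxx mul1r big1 ?addr0 // => y /negPf xy.
by rewrite eq_sym xy mul0r.
Qed.

Lemma sum_indicator (x : V) : \S_y (x == y)%:R = 1 :> R.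
Proof.
rewrite -[RHS](sum_eq_indicator x (fun=> 1)).
by apply: eq_avg => y; rewrite mulr1.
Qed.

(** Inclusion-exclusion: each of the three coincidences leaves [n - d x] pairs, and the triple
    coincidence is restored with coefficient 2. *)
Lemma coindep_distinct x :
  \S_y \S_z b x y * b x z * b y z * ((x != y)%:R * (x != z)%:R * (y != z)%:R) =
  mcoindep 1 A x - 3%:R * (n - d x) + 2%:R.
Proof.
have nd : n - d x = \S_y b x y.
  by rewrite -avgB; apply: eq_avg => y; rewrite nadjrE.
pose t y z := b x y * b x z * b y z - (x == y)%:R * b x z - (x == z)%:R * b x y
  - (y == z)%:R * b x z + 2%:R * ((x == y)%:R * (x == z)%:R).
have bxx : b x x = 1 by rewrite /nadjr A_irr.
have -> : \S_y \S_z b x y * b x z * b y z * ((x != y)%:R * (x != z)%:R * (y != z)%:R)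
    = \S_y \S_z t y z.
  apply: eq_avg => y; apply: eq_avg => z; rewrite /t.
  have [<-|xy] := eqVneq x y; rewrite /= ?bxx.
    have [<-|xz] := eqVneq x z; rewrite /= ?bxx; first by ring.
    rewrite !(mul0r, mulr0, mul1r) subr0 addr0 /nadjr.
    by case: (A x z); rewrite /= ?eqxx; ring.
  have [<-|xz] := eqVneq x z; rewrite /= ?bxx.
    rewrite eq_sym (negPf xy) /nadjr (A_sym y x).
    by case: (A x y); rewrite /=; ring.
  have [<-|yz] := eqVneq y z; rewrite /=; last by ring.
  by rewrite /nadjr A_irr; case: (A x y); rewrite /=; ring.
rewrite nd; have -> : \S_y \S_z t y z = \S_y ((\S_z b x y * b x z * b y z)
    - (x == y)%:R * (\S_z b x z) - 1 * b x y - b x y + 2%:R * (x == y)%:R).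
  apply: eq_avg => y; rewrite /t avgD !avgB !avgZ; congr (_ - _ - _ - _ + 2%:R * _).
  - by rewrite (sum_eq_indicator x (fun=> b x y)) mul1r.
  - by rewrite sum_eq_indicator.
  - by rewrite sum_indicator mulr1.
rewrite avgD !avgB avgZ (sum_eq_indicator x (fun=> \S_z b x z)).
rewrite !avgZ sum_indicator -/(mcoindep 1 A x); ring.
Qed.

Lemma exact_count_copattern : exact_count R A = (copattern_count A)%:R.
Proof.
have -> : (copattern_count A)%:R =
    \S_x \S_y \S_z \S_t (copattern_inj A x y z t)%:R :> R.
  rewrite avg1E natr_sum; apply: eq_bigr => x _; rewrite avg1E natr_sum.
  apply: eq_bigr => y _; rewrite avg1E natr_sum; apply: eq_bigr => z _.
  by rewrite avg1E natr_sum.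
rewrite /exact_count /copattern_density -avgB; apply: eq_avg => x.
have := coindep_distinct x; set s := \S_y _ => sE.
transitivity (d x * s); first by rewrite sE; ring.
rewrite mulrC -avgZr; apply: eq_avg => y; rewrite -avgZr; apply: eq_avg => z.
rewrite -avgZ; apply: eq_avg => t; rewrite /copattern_inj /adjr /nadjr.
by rewrite -!natrM !mulnb; congr (nat_of_bool _)%:R; rewrite !andbA andbC !andbA.
Qed.

(** [cherry] ignores one vertex and [ends] two; summing over these gives powers of [n] that cancel
    the additional powers of [w]. *)
Lemma normalized_countE w : w * n = 1 ->
  normalized_count w A = w ^+ 4 * exact_count R A.
Proof.
move=> wn.
have mean4E (g : V -> V -> V -> V -> R) : mean4 w g = w ^+ 4 * mean4 1 g.
  rewrite /mean4 avg_scale [w ^+ 4]exprS -mulrA; congr (_ * _); rewrite -avgZ.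
  apply: eq_avg => x; rewrite avg_scale [w ^+ 3]exprS -mulrA; congr (_ * _); rewrite -avgZ.
  apply: eq_avg => y; rewrite avg_scale [w ^+ 2]exprS -mulrA; congr (_ * _); rewrite -avgZ.
  by apply: eq_avg => z; rewrite avg_scale.
have copatE : mean4 1 (copat R A) = copattern_density 1 A by exact: mean4_copat.
have cherryE : mean4 1 (cherry R A) = n * \S_x d x * (n - d x).
  rewrite mulrC -avgZr; apply: eq_avg => x.
  have -> : n - d x = \S_y b x y by rewrite -avgB; apply: eq_avg => y; rewrite nadjrE.
  transitivity (\S_y b x y * (d x * n)); last by rewrite avgZr; ring.
  apply: eq_avg => y; rewrite mulrA [b x y * _]mulrC -avg_cst.
  by apply: eq_avg => z; rewrite avgZr.
have endsE : mean4 1 (ends R A) = n ^+ 2 * \S_x d x.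
  rewrite mulrC -avgZr; apply: eq_avg => x.
  by rewrite expr2 mulrA -!avg_cst.
rewrite /normalized_count !mean4E copatE cherryE endsE /exact_count.
have -> : \S_x d x * (3%:R * (n - d x) - 2%:R) =
    3%:R * (\S_x d x * (n - d x)) - 2%:R * \S_x d x.
  by rewrite -!avgZ -avgB; apply: eq_avg => x; ring.
set p := \S_x d x * (n - d x); set q := \S_x d x.
have -> : 3%:R * w * (w ^+ 4 * (n * p)) = 3%:R * w ^+ 4 * p * (w * n) by ring.
have -> : 2%:R * w ^+ 2 * (w ^+ 4 * (n ^+ 2 * q)) =
    2%:R * w ^+ 4 * q * (w * n) ^+ 2 by ring.
by rewrite wn; ring.
Qed.

End CountsAsSums.

(** * Complete bipartite graphs *)

Section BipartiteCount.

Variables (R : realFieldType) (V : finType) (X : {set V}).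

Definition bipartite_rel : rel V := fun x y => (x \in X) (+) (y \in X).

Lemma bipartite_rel_sym : symmetric bipartite_rel.
Proof. by move=> x y; rewrite /bipartite_rel addbC. Qed.

Lemma bipartite_rel_irr : irreflexive bipartite_rel.
Proof. by move=> x; rewrite /bipartite_rel addbb. Qed.

Local Notation "'\S_' x F" := (avg 1 (fun x : V => F))
  (at level 41, x name, F at level 41).
Local Notation n := (avg 1 (fun _ : V => 1 : R)).

(** Every vertex is adjacent to exactly one end of an edge, so the deficit vanishes. As the degree
    sum is [(n ^ 2 - r ^ 2) / 2], the rest is completing the square. *)
Lemma bipartite_exact_count : let r := n - 2%:R * #|X|%:R in
  exact_count R bipartite_rel = (n ^+ 2 - 3%:R * n + 4%:R) ^+ 2 / 8%:R
    - (3%:R * n - 4%:R - r ^+ 2) ^+ 2 / 8%:R.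
Proof.
move=> r; rewrite exact_countE; last exact: bipartite_rel_sym.
have -> : edge_avg 1 bipartite_rel (exact_deficit R bipartite_rel) = 0.
  transitivity (edge_avg (1 : R) bipartite_rel (fun _ _ => 0 * 0)).
    2: by rewrite edge_avgZ mul0r.
  apply: eq_avg => x; apply: eq_avg => y.
  case Bxy: (bipartite_rel x y); last by rewrite /adjr Bxy !mul0r.
  have nn z : nadjr R bipartite_rel x z * nadjr R bipartite_rel y z = 0.
    move: Bxy; rewrite /nadjr /bipartite_rel.
    by case: (x \in X); case: (y \in X); case: (z \in X); rewrite //= ?mulr0 ?mul0r.
  have aa z : adjr R bipartite_rel x z * adjr R bipartite_rel y z = 0.
    move: Bxy; rewrite /adjr /bipartite_rel.
    by case: (x \in X); case: (y \in X); case: (z \in X); rewrite //= ?mulr0 ?mul0r.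
  have avg0 : \S__ (0 : R) = 0 by rewrite avg_cst mul0r.
  have far0 : mfar (1 : R) bipartite_rel x y = 0 by rewrite -avg0; apply: eq_avg.
  have cod0 : mcodeg (1 : R) bipartite_rel x y = 0 by rewrite -avg0; apply: eq_avg.
  have deg0 : far_degree (1 : R) bipartite_rel x y = 0.
    by rewrite -avg0; apply: eq_avg => z; rewrite nn mul0r.
  by rewrite /exact_deficit /edge_deficit far0 cod0 deg0; ring.
pose k : R := #|X|%:R; pose s x : R := (x \in X)%:R.
have sE : \S_x s x = k by rewrite avg1E -natr_sum /k -sum1_card [in RHS]big_mkcond.
have -> : \S_x mdeg (1 : R) bipartite_rel x = 2%:R * k * (n - k).
  have -> : \S_x mdeg (1 : R) bipartite_rel x = \S_x (s x * (n - k) + k * (1 - s x)).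
    apply: eq_avg => x; rewrite -sE -avgB -avgZ -avgZr -avgD; apply: eq_avg => y.
    rewrite /adjr /bipartite_rel /s; case: (x \in X); case: (y \in X); rewrite /=; ring.
  by rewrite avgD avgZr avgZ avgB sE; ring.
by rewrite /r -/k; field.
Qed.

End BipartiteCount.

(* Taking the least part size k with (n - 2k)^2 <= 3n makes (n - 2k)^2 as close
   to its optimal value 3n - 4 as parity permits. *)
Lemma near_optimal_bipartition (R : realFieldType) (V : finType) : (1000 <= #|V|)%N ->
  let n : R := #|V|%:R in exists X : {set V},
  (n ^+ 2 - 3%:R * n + 4%:R) ^+ 2 / 8%:R - 6%:R * n <=
  exact_count R (bipartite_rel X).
Proof.
move=> n1000 n; pose N := #|V|.
have ex : exists k, ((N - 2 * k) ^ 2 <= 3 * N)%N.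
  by exists N; rewrite (_ : (N - 2 * N)%N = 0%N) //; lia.
have [k kP kmin] := ex_minnP ex.
have k0 : (0 < k)%N.
  rewrite lt0n; apply: contraTneq kP => ->; rewrite -ltnNge /N muln0 subn0.
  by rewrite expnS expn1 ltn_pmul2r; lia.
have k2 : (2 * k <= N)%N.
  rewrite leqNgt; apply/negP => lt; have := kmin k.-1.
  have -> : (N - 2 * k.-1 <= 1)%N -> ((N - 2 * k.-1) ^ 2 <= 3 * N)%N.
    by move=> h; apply: leq_trans (_ : 1 ^ 2 <= _)%N; [rewrite leq_exp2r | lia].
  - by move=> /(_ isT); lia.
  - by lia.
have kN : (k <= N)%N by lia.
have [X _ cX] : exists2 X : {set V}, X \subset [set: V] & #|X| = k.
  exists [set x in take k (enum V)]; first exact: subsetT.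
  rewrite cardsE (card_uniqP _) ?take_uniq ?enum_uniq // size_takel //.
  by rewrite -cardE.
exists X; rewrite bipartite_exact_count card_avg cX -/n.
have up : ((N - 2 * k) ^ 2 <= 3 * N)%N by [].
have low : (3 * N < (N - 2 * k + 2) ^ 2)%N.
  rewrite ltnNge; apply/negP => h; have := kmin k.-1.
  by rewrite (_ : (N - 2 * k.-1 = N - 2 * k + 2)%N); [move=> /(_ h); lia | lia].
pose r : R := (N - 2 * k)%:R.
have rE : n - 2%:R * k%:R = r by rewrite /r natrB // natrM.
have up' : r ^+ 2 <= 3%:R * n by rewrite -natrX -natrM ler_nat.
have low' : 3%:R * n < (r + 2%:R) ^+ 2 by rewrite -natrD -natrX -natrM ltr_nat.
have r0 : 0 <= r by exact: ler0n.
have n_big : 1000%:R <= n by rewrite ler_nat.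
rewrite rE; move: up' low' r0 n_big; clear; move: r n => r n up low r0 n1000.
(* Minimality of [k] gives [3 n < (r + 2) ^ 2], so the base is at most [4 r], and
   [(4 r) ^ 2 <= 48 n]; it is also at least [-4]. Dividing by 8 yields the error [6 n]. *)
have : (3%:R * n - 4%:R - r ^+ 2) ^+ 2 <= 48%:R * n; last by lra.
have r2 : (4%:R * r) ^+ 2 <= 48%:R * n by rewrite exprMn; move: up; clear; lra.
have h1 : 3%:R * n - 4%:R - r ^+ 2 <= 4%:R * r by move: low; clear; rewrite !expr2; lra.
have h2 : -4%:R <= 3%:R * n - 4%:R - r ^+ 2 by move: up; clear; lra.
case: (lerP 0 (3%:R * n - 4%:R - r ^+ 2)) => [h|/ltW h].
  by apply: le_trans r2; rewrite ler_sqr ?nnegrE // mulr_ge0.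
rewrite -sqrrN (le_trans (y := 4%:R ^+ 2)) //.
  by rewrite ler_sqr ?nnegrE ?oppr_ge0 // lerNl.
by move: n1000; clear; rewrite expr2; lra.
Qed.

(** * Extremal graphs have no odd triples *)

Section Extremal.

Variables (R : realFieldType) (V : finType) (A : rel V).
Hypotheses (A_sym : symmetric A) (A_irr : irreflexive A).
Hypothesis A_max : forall B : rel V, symmetric B -> irreflexive B ->
  (copattern_count B <= copattern_count A)%N.

Local Notation n := (#|V|%:R : R).
Local Notation w := (n^-1).
Local Notation u := (200%:R^-1 : R).
Hypothesis n_huge : 500%:R * 200%:R ^+ 8 <= n.

Let n_large : 1000%:R <= n.
Proof.
apply: le_trans n_huge; have h : 1 <= 200%:R ^+ 7 :> R by rewrite exprn_ege1 // ler1n.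
by rewrite exprS mulrA; move: h; move: (200%:R ^+ 7 : R) => q; lra.
Qed.

Let n_gt0 : 0 < n. Proof. by apply: lt_le_trans n_large; rewrite ltr0n. Qed.
Let w_gt0 : 0 < w. Proof. by rewrite invr_gt0. Qed.
Let w_ge0 : 0 <= w. Proof. exact: ltW. Qed.

Let wn : w * avg (1 : R) (fun _ : V => 1) = 1.
Proof. by rewrite card_avg mulVf // gt_eqF. Qed.

Let w_mean : avg w (fun _ : V => 1) = 1.
Proof. by rewrite avg_scale wn. Qed.

Let w_small : 500%:R * w <= u ^+ 8.
Proof.
by rewrite ler_pdivrMr // exprVn mulrC ler_pdivlMr ?exprn_gt0 ?ltr0n.
Qed.

Let u_gt0 : 0 < u. Proof. by rewrite invr_gt0 ltr0n. Qed.
Let u_le1 : u <= 1. Proof. lra. Qed.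

Let u8 : u ^+ 8 <= u ^+ 2 * u ^+ 2.
Proof. by rewrite -exprD; apply: ler_wiXn2l => //; exact: ltW. Qed.

Let w_le : w <= 1000%:R^-1.
Proof. by rewrite lef_pV2 ?posrE // ltr0n. Qed.

Lemma exact_count_max (B : rel V) : symmetric B -> irreflexive B ->
  exact_count R B <= exact_count R A.
Proof.
by move=> B_sym B_irr; rewrite !exact_count_copattern // ler_nat A_max.
Qed.

Lemma exact_count_lower :
  (n ^+ 2 - 3%:R * n + 4%:R) ^+ 2 / 8%:R - 6%:R * n <= exact_count R A.
Proof.
have [|X HX] := @near_optimal_bipartition R V; first by rewrite -(ler_nat R).
apply: le_trans HX (exact_count_max _ _).
- exact: bipartite_rel_sym.
- exact: bipartite_rel_irr.
Qed.

(** The bipartite lower bound, scaled by [w ^ 4], is [1/8 - 3 w / 4] up to terms of higher order,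
    which the remaining [w / 4] absorbs. *)
Lemma extremal_density : 8%:R^-1 - w <= copattern_density w A.
Proof.
have cherry_ge0 : 0 <= mean4 w (cherry R A).
  by apply: mean4_ge0 => // x y z t; rewrite mulr_ge0 ?ler0n.
have ends_le1 : mean4 w (ends R A) <= 1.
  by apply: mean4_le1 => // x y z t; rewrite /ends /adjr lern1 leq_b1.
have := normalized_countE A wn; rewrite /normalized_count mean4_copat.
have wC : w ^+ 4 * ((n ^+ 2 - 3%:R * n + 4%:R) ^+ 2 / 8%:R - 6%:R * n) =
    (1 - 3%:R * w + 4%:R * w ^+ 2) ^+ 2 / 8%:R - 6%:R * w ^+ 3.
  by field; rewrite gt_eqF.
have := ler_wpM2l (exprn_ge0 4 w_ge0) exact_count_lower; rewrite wC.
have h1 : 0 <= w * mean4 w (cherry R A) by rewrite mulr_ge0.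
have h2 : w ^+ 2 * mean4 w (ends R A) <= w ^+ 2 by rewrite ler_piMr ?sqr_ge0.
have h3 : w ^+ 2 <= w * 1000%:R^-1 by rewrite expr2 ler_wpM2l.
have h4 : w ^+ 3 <= w * 1000%:R^-1.
  rewrite exprS (le_trans _ h3) // expr2 mulrA ler_piMr ?mulr_ge0 //.
  by rewrite (le_trans w_le) //; lra.
have h5 : 0 <= (3%:R * w - 4%:R * w ^+ 2) ^+ 2 by exact: sqr_ge0.
have -> : (1 - 3%:R * w + 4%:R * w ^+ 2) ^+ 2 =
   1 - 6%:R * w + 8%:R * w ^+ 2 + (3%:R * w - 4%:R * w ^+ 2) ^+ 2 by ring.
move: h1 h2 h3 h4 h5 (sqr_ge0 w) w_ge0.
move: (copattern_density w A) (exact_count R A) (mean4 w (cherry R A))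
  (mean4 w (ends R A)) w => D X c e q; lra.
Qed.

(** Degree concentration with [t = u ^ 4] asks for [452 w <= u ^ 8]; this determines the size of
    [n_huge]. *)
Lemma extremal_variance :
  avg w (fun x => (mdeg w A x - 2%:R^-1) ^+ 2) <= (u ^+ 2) ^+ 2.
Proof.
apply: degree_concentration => //.
  by rewrite -exprM exprn_gt0 //= exprn_ile1 // ltW.
apply: le_trans (_ : 452%:R * w <= _).
  by rewrite ler_wpM2l ?ler0n //; have := extremal_density; lra.
rewrite -!exprM; apply: le_trans w_small; rewrite ler_wpM2r // ler_nat.
by [].
Qed.

Lemma extremal_degrees x :
  mdeg w A x <= u \/ `|mdeg w A x - 2%:R^-1| <= u.
Proof.
have u0 := u_gt0.
have u2 : u ^+ 2 = u / 200%:R by rewrite expr2.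
have dev := mean_dev_le w_gt0 w_mean (exprn_gt0 2 u0) extremal_variance.
have w1 : w <= 1 by apply: le_trans w_le _; lra.
(* [318 = 4 + 314]: four times the loss in density, plus the clone error. *)
have low : 2%:R^-1 - 318%:R * w <= role_sum w A x.
  have := role_sum_lower w_gt0 w1 w_mean (v := x) (A := A).
  have opt v : normalized_count w (cloned A v x) <= normalized_count w A.
    have cs : symmetric (cloned A v x) by move=> y z; rewrite /cloned A_sym.
    have ci : irreflexive (cloned A v x) by move=> y; rewrite /cloned A_irr.
    by rewrite !normalized_countE // ler_wpM2l ?exprn_ge0 ?exact_count_max.
  move=> /(_ opt); have := extremal_density.
  by move: (role_sum w A x) (copattern_density w A) => r D; lra.
apply: (degree_dichotomy w_gt0 w_mean A_sym _ low).
  by rewrite u0 lef_pV2 ?posrE ?ltr0n // ler_nat.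
(* [10 * mean_dev] is at most [20 u ^ 2 = u / 10], below [u / 8] with room for [318 w]. *)
move: dev w_small u8 u0; rewrite u2; move: (mean_dev w A) w => T q.
have : u = 200%:R^-1 by [].
move: (u ^+ 8) => r _; lra.
Qed.

Local Notation N := (avg (1 : R) (fun _ : V => 1)).

Lemma extremal_degrees_scaled x : mdeg (1 : R) A x <= N / 200%:R \/
  `|mdeg (1 : R) A x - N / 2%:R| <= N / 200%:R.
Proof.
have nw : n * w = 1 by rewrite mulfV // gt_eqF.
have degE : mdeg w A x = w * mdeg 1 A x by exact: avg_scale.
rewrite card_avg; case: (extremal_degrees x); rewrite degE => h; [left | right].
  have := ler_wpM2l (ltW n_gt0) h; rewrite mulrA nw mul1r.
  by move: (mdeg 1 A x) n => D k; lra.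
have := ler_wpM2l (ltW n_gt0) h; rewrite -{1}(ger0_norm (ltW n_gt0)) -normrM mulrBr.
by rewrite mulrA nw mul1r.
Qed.

(** Chebyshev's argument: the squared deviation of a sparse vertex is at least [1/5], so the
    proportion of sparse vertices is at most [5 u ^ 4]. *)
Lemma extremal_few_sparse : avg 1 (sparse R A) <= N / 200%:R.
Proof.
have nw : n * w = 1 by rewrite mulfV // gt_eqF.
have : avg w (sparse R A) <= 5%:R * (u ^+ 2) ^+ 2.
  apply: le_trans (ler_wpM2l (ler0n _ _) extremal_variance); rewrite -avgZ.
  apply: le_avg => // x; rewrite /sparse.
  case: (lerP (mdeg 1 A x) (N / 200%:R)) => [low|_]; last first.
    by rewrite mulr_ge0 ?sqr_ge0.
  have degE : mdeg w A x = w * mdeg 1 A x by exact: avg_scale.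
  have : mdeg w A x <= u.
    rewrite degE; have := ler_wpM2l w_ge0 low; rewrite card_avg mulrA mulVf ?gt_eqF //.
    by rewrite mul1r.
  move: (mdeg w A x) => D h.
  have : 0 <= (200%:R^-1 - D) * (199%:R / 200%:R - D) by rewrite mulr_ge0 //; lra.
  by rewrite /= expr2; lra.
rewrite avg_scale card_avg => h; have := ler_wpM2l (ltW n_gt0) h.
rewrite mulrA nw mul1r => /le_trans; apply; rewrite ler_wpM2l // ?ltW //.
rewrite expr2; lra.
Qed.

(** An odd triple would cost at least [n ^ 2 / 30] without sparse vertices and [n ^ 2 / 4] with
    them, more than the permitted [6 n]. *)
Theorem extremal_no_odd_triple x y z : ~~ odd_triple A x y z.
Proof.
apply/negP => odd_xyz; have low := exact_count_lower.
have N1000 : 1000%:R <= N by rewrite card_avg.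
have NN : 1000%:R * n <= n ^+ 2 by rewrite expr2 ler_wpM2r // ltW.
pose k : nat := (\sum_(v : V) (mdeg (1 : R) A v <= N / 200%:R)%R)%N.
have kE : avg 1 (sparse R A) = k%:R by rewrite avg1E natr_sum.
case: (posnP k) => [k0|k_gt0].
  have reg v : `|mdeg (1 : R) A v - N / 2%:R| <= N / 200%:R.
    case: (extremal_degrees_scaled v) => // h; move/eqP: k0.
    by rewrite /k sum_nat_eq0 => /forallP/(_ v); rewrite h.
  have := regular_bound A_sym N1000 A_irr reg odd_xyz; rewrite card_avg.
  by move: (n ^+ 2) NN low n_gt0 => q; lra.
have few := extremal_few_sparse.
have k23 : avg 1 (sparse R A) <= 2%:R \/ 3%:R <= avg 1 (sparse R A).
  by rewrite kE !ler_nat; case: (leqP k 2); [left | right].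
have k1 : 1 <= avg 1 (sparse R A) by rewrite kE ler1n.
have := sparse_bound A_sym N1000 extremal_degrees_scaled k1 few k23; rewrite card_avg.
by move: (n ^+ 2) NN low n_gt0 => q; lra.
Qed.

End Extremal.

(** Evenness of the triples through a vertex [x0] says that [u] and [v] are adjacent exactly when
    one of them is a neighbour of [x0] and the other is not. Without any vertex both parts are
    empty. *)
Lemma blowup_of_no_odd_triple (V : finType) (G : graph V) :
  (forall x y z, ~~ odd_triple (adj G) x y z) -> blowup_K2 G.
Proof.
move=> even; case: (pickP (@predT V)) => [x0 _|V0]; last first.
  exists set0, [set: V]; split; first by rewrite set0U.
    by rewrite -setI_eq0 set0I.
  by move=> u; have := V0 u.
pose X := [set x | adj G x0 x]; exists X, (~: X); split.
- exact: setUCr.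
- by rewrite -setI_eq0 setICr.
move=> u v; rewrite !inE; move: (even x0 u v); rewrite /odd_triple.
by case: (adj G x0 u); case: (adj G x0 v); case: (adj G u v).
Qed.

Lemma exists_nat_ge (x : rat) : exists k : nat, x <= k%:R.
Proof.
exists (Num.Def.archi_bound `|x|); apply: le_trans (ler_norm x) (ltW _).
exact: archi_boundP.
Qed.

Local Close Scope ring_scope.

Theorem theorem3p16 :
  exists n0 : nat, forall n : nat, n0 <= n ->
  forall (V : finType) (G : graph V),
    #|V| = n -> Lambda H G = Lambda_max H n -> blowup_K2 G.
Proof.
(* The ordered field is taken to be the rationals. *)
have [n0 n0P] := exists_nat_ge (500%:R * 200%:R ^+ 8)%R.
exists n0 => n n0n V G cardV maxG.
have A_max (B : rel V) : symmetric B -> irreflexive B ->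
    copattern_count B <= copattern_count (adj G).
  move=> B_sym B_irr; rewrite -Lambda_copattern maxG -cardV.
  exact: copattern_count_le_max.
have big : (500%:R * 200%:R ^+ 8 <= #|V|%:R :> rat)%R.
  by apply: (le_trans n0P); rewrite ler_nat cardV.
exact (blowup_of_no_odd_triple
  (extremal_no_odd_triple (adj_sym G) (adj_irr G) A_max big)).
Qed.
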